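(* Suppose that $c$ satisfies the extended twist condition (given in the context). Let $n\in\mathbb N$, and for $i\in\{1,\dots,n\}$ let $y_i\in Y$ be distinct and $m_i>0$ be such that $\sum_{i=1}^nm_i=1$. Let $\nu=\sum_{i=1}^nm_i\delta_{y_i}$ and let $\bar p$ be the unique minimiser of $F_\nu$ over $\mathcal P_{\mathrm{ac}}(B)$. Let $y_{\mathrm{ext}},c_{\mathrm{ext}},\mu_{\mathrm{ext}},\nu_{\mathrm{ext}}$ and $P$ be as in the context, and let $\psi_{\mathrm{ext}}$ be a Kantorovich potential between $\mu_{\mathrm{ext}}$ and $\nu_{\mathrm{ext}}$ for the cost $c_{\mathrm{ext}}$. Set $y_{n+1}:=y_{\mathrm{ext}}$, $\Psi:=(\psi_{\mathrm{ext}}(y_i))_{i=1}^{n+1}$, $\mathbf y:=(y_i)_{i=1}^{n+1}$, and for $i\in\{1,\dots,n+1\}$ define $$L_i(\Psi,\mathbf y):=\bigl\{x\in B\times[0,P]\ \big|\ c_{\mathrm{ext}}(x,y_i)-\Psi_i\le c_{\mathrm{ext}}(x,y_j)-\Psi_j\quad\forall\,j\in\{1,\dots,n+1\}\bigr\}.$$ Then $$\mathrm{graph}(\bar p)\subseteq\partial L_{n+1}(\Psi,\mathbf y),$$ and $T:X_{\bar p}\to Y$ defined by $$T:=\sum_{i=1}^ny_i\,\mathbf 1_{L_i(\Psi,\mathbf y)}$$ is the optimal transport map from $\mu_{\bar p}$ to $\nu$ for the cost $c$.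
   Context: Setting. Let $d\ge 2$, let $B\subset\mathbb R^{d-1}$ be compact with non-empty interior, let $X:=B\times[0,+\infty)$ with points written $x=(s,p)$, and let $Y\subset\mathbb R^d$ be non-empty and compact. The cost $c:X\times Y\to[0,+\infty)$ satisfies: (A) $c$ is locally Lipschitz; (B) for all $s\in B$ and $y\in Y$ the function $c((s,\cdot),y):[0,+\infty)\to[0,+\infty)$ is strictly increasing and unbounded; (C) the set of functions $\{c((\cdot,p),y):B\to[0,+\infty)\mid p\in[0,+\infty),\,y\in Y\}$ is equicontinuous. Extended twist condition: there exist open sets $\Omega_X,\Omega_Y\subset\mathbb R^d$ with $X\subset\Omega_X$, $Y\subset\Omega_Y$ and an extension of $c$ to $\Omega_X\times\Omega_Y$ such that $c\in\mathcal C^1(\Omega_X\times\Omega_Y)$, for all $x_0\in\Omega_X$ the map $\nabla_xc(x_0,\cdot):\Omega_Y\to\mathbb R^d$ is injective, and there is a constant $\ell>0$ such that $\min_{y\in Y}\|\nabla_xc(x_0,y)\|\ge\ell$ for all $x_0\in\Omega_X$. Notation. $\mathcal C(A)$: continuous real functions on $A$; $\mathcal P_{\mathrm{ac}}(B)$: Borel probability measures on $B$ absolutely continuous with respect to $\mathcal L^{d-1}$, identified with their densities. $\mathcal L^d|_A$ is the restriction of Lebesgue measure to $A$; $\delta_y$ is the Dirac mass at $y$; $\mathbf 1_A$ is the characteristic function of $A$; $\partial A$ is the boundary of $A\subseteq\mathbb R^d$. For $\bar p\in\mathcal P_{\mathrm{ac}}(B)$: $X_{\bar p}:=\{(s,p)\in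 X:p\le\bar p(s)\}$ and $\mu_{\bar p}:=\mathcal L^d|_{X_{\bar p}}$. $F_\nu(\bar p):=\inf_{\gamma\in\Gamma(\mu_{\bar p},\nu)}\int_{X\times Y}c\,\mathrm d\gamma$, where $\Gamma(\mu,\nu)$ is the set of measures on the product space with marginals $\mu,\nu$; $F_\nu$ has a unique minimiser over $\mathcal P_{\mathrm{ac}}(B)$, which has a continuous density, and the minimiser $\bar p$ is represented by that continuous density. An optimal transport map from $\mu$ to $\nu$ for $c$ is a Borel map $T$ with $T_\#\mu=\nu$ (pushforward) minimising $\int c(x,T(x))\,\mathrm d\mu(x)$ among all such maps. The intersection of any two distinct sets $L_i(\Psi,\mathbf y)$ is $\mathcal L^d$-negligible, and $T$ is understood up to $\mathcal L^d$-null sets. $\mathrm{graph}(f):=\{(s,f(s)):s\in B\}$ for $f:B\to\mathbb R$. Define $q:B\times Y\times\mathbb R\to[0,+\infty)$ by $q(s,y,\sigma):=c((s,\cdot),y)^{-1}(\sigma)$ if $\sigma\ge c((s,0),y)$, and $0$ otherwise. For each $\psi\in\mathcal C(Y)$, $\tau_\psi\in\mathbb R$ is the unique constant such that $\bar p_\psi(s):=\max_{y\in Y}q(s,y,\psi(y)+\tau_\psi)$ is a probability density on $B$. The set $\mathcal S=\{\bar p_\psi\mid\psi\in\mathcal C(Y)\}$ is uniformly bounded; $P>0$ is a uniform upper bound on $\mathcal S$. Extended objects. $y_{\mathrm{ext}}\in\mathbb R^d\setminus Y$; $Y_{\mathrm{ext}}:=Y\cup\{y_{\mathrm{ext}}\}$;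 $c_{\mathrm{ext}}:X\times Y_{\mathrm{ext}}\to[0,+\infty)$ equals $c$ for $y\in Y$ and $0$ for $y=y_{\mathrm{ext}}$; $\mu_{\mathrm{ext}}:=\mathcal L^d|_{B\times[0,P]}$; $\nu_{\mathrm{ext}}:=\nu+(P-1)\delta_{y_{\mathrm{ext}}}$. A Kantorovich potential between $\mu_{\mathrm{ext}}$ and $\nu_{\mathrm{ext}}$ for $c_{\mathrm{ext}}$ is a maximiser over $\varphi\in\mathcal C(Y_{\mathrm{ext}})$ of $\int\varphi^{c_{\mathrm{ext}}}\,\mathrm d\mu_{\mathrm{ext}}+\int\varphi\,\mathrm d\nu_{\mathrm{ext}}$, where $\varphi^{c_{\mathrm{ext}}}(x):=\min_{y\in Y_{\mathrm{ext}}}\{c_{\mathrm{ext}}(x,y)-\varphi(y)\}$.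
   Formalization: P is taken as a strict upper bound: every density in S is < P at every point of B. With an attained bound (B the unit cube, Y={0}, c=p, P=1) the graph inclusion fails. The continuous density of the minimiser is assumed unique on B. *)

(* Defs.v *)
From HB Require Import structures.
From mathcomp Require Import all_boot all_order all_algebra.
From mathcomp Require Import all_classical all_reals all_analysis.

Set Implicit Arguments.
Unset Strict Implicit.
Unset Printing Implicit Defensive.
Import Order.TTheory GRing.Theory Num.Theory.
Import numFieldNormedType.Exports.

Local Open Scope classical_set_scope.
Local Open Scope ring_scope.

(* R^n carries the product sigma-algebra of the Borel sets of R, i.e. the one
   generated by the coordinate maps; it coincides with the Borel sigma-algebra
   of R^n. *)
Section measurable_rV.
Context (R : realType) (n : nat).

Let coors (i : 'I_n) (v : 'rV[R]_n) : R := v 0 i.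

Let rV_set0 : g_sigma_preimage coors set0.
Proof. exact: sigma_algebra0. Qed.

Let rV_setC A : g_sigma_preimage coors A -> g_sigma_preimage coors (~` A).
Proof. exact: sigma_algebraC. Qed.

Let rV_bigcup (F : _^nat) : (forall i, g_sigma_preimage coors (F i)) ->
  g_sigma_preimage coors (\bigcup_i (F i)).
Proof. exact: sigma_algebra_bigcup. Qed.

HB.instance Definition _ := @isMeasurable.Build default_measure_display
  'rV[R]_n (g_sigma_preimage coors) rV_set0 rV_setC rV_bigcup.

Lemma measurable_coord (i : 'I_n) :
  measurable_fun [set: 'rV[R]_n] (fun v : 'rV[R]_n => v 0 i).
Proof.
move=> _ Y mY; rewrite setTI; apply: sub_sigma_algebra => /=.
rewrite -bigcup_seq/=; exists i => /=; first by rewrite mem_index_enum.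
by exists Y => //; rewrite setTI.
Qed.

Lemma measurable_fun_rV d (T : measurableType d) (f : T -> 'rV[R]_n) :
  (forall i, measurable_fun [set: T] (fun t => f t 0 i)) ->
  measurable_fun [set: T] f.
Proof.
move=> mf _ A mA; rewrite setTI.
suff : g_sigma_preimage coors `<=` [set B | measurable (f @^-1` B)] by exact.
apply: smallest_sub.
  split=> /=; first by rewrite preimage_set0.
    by move=> B mB; rewrite setTD preimage_setC; exact: measurableC.
  by move=> F mF; rewrite preimage_bigcup; exact: bigcup_measurable.
rewrite -bigcup_seq => B [i _ [C mC <-]]; rewrite setTI /=.
by have := mf i measurableT C mC; rewrite setTI.
Qed.

End measurable_rV.

Section lebesgue_rV.
Context (R : realType).

Definition rV_cons n (z : R * 'rV[R]_n) : 'rV[R]_n.+1 :=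
  row_mx (z.1%:M : 'rV[R]_1) z.2.

(* lebesgue_measure lives on the alias measurableTypeR R of R, whose
   sigma-algebra is that of R up to conversion but whose display differs. *)
Definition lebesgue_R : set R -> \bar R := @lebesgue_measure R.

Let lebesgue_R_ge0 (A : set R) : (0 <= lebesgue_R A)%E.
Proof. exact: measure_ge0. Qed.

Let lebesgue_R_sigma_additive : semi_sigma_additive lebesgue_R.
Proof. exact: (@measure_semi_sigma_additive _ _ _ (@lebesgue_measure R)). Qed.

HB.instance Definition _ := isMeasure.Build _ R R lebesgue_R
  (measure0 (@lebesgue_measure R)) lebesgue_R_ge0 lebesgue_R_sigma_additive.

Let lebesgue_R_sigma_finite : sigma_finite setT lebesgue_R.
Proof. exact: (@sigma_finiteT _ _ _ (@lebesgue_measure R)). Qed.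

HB.instance Definition _ := Measure_isSigmaFinite.Build _ _ _ lebesgue_R
  lebesgue_R_sigma_finite.

(* Lebesgue measure on R^n, by L^(n+1) = L^1 x L^n *)
Fixpoint lebesgue_rV n : set 'rV[R]_n -> \bar R :=
  match n with
  | 0 => dirac (0 : 'rV[R]_0)
  | n'.+1 => pushforward (lebesgue_R \x @lebesgue_rV n')%E
               (@rV_cons n')
  end.

Definition rV_uncons n (v : 'rV[R]_n.+1) : R * 'rV[R]_n :=
  (v 0 0, \row_i v 0 (lift ord0 i)).

Lemma rV_consK n : cancel (@rV_cons n) (@rV_uncons n).
Proof.
move=> [t v]; rewrite /rV_uncons /rV_cons; congr pair => /=.
  rewrite mxE; case: splitP => // j _.
  by rewrite ord1 mxE eqxx mulr1n.
apply/rowP => i; rewrite !mxE; case: splitP => j /=.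
  by rewrite ord1.
by rewrite /bump/= !add1n => -[] /val_inj ->.
Qed.

Lemma rV_unconsK n : cancel (@rV_uncons n) (@rV_cons n).
Proof.
move=> v; rewrite /rV_uncons /rV_cons /=; apply/rowP => i.
rewrite !mxE; case: splitP => j ij.
  rewrite ord1 mxE eqxx mulr1n; congr (v 0 _).
  by apply: val_inj; rewrite /= ij ord1.
rewrite mxE; congr (v 0 _); apply: val_inj => /=.
by rewrite ij /bump add1n.
Qed.

Lemma measurable_rV_cons n : measurable_fun setT (@rV_cons n).
Proof.
apply: measurable_fun_rV => i.
rewrite /rV_cons; have [j ij|j ij] := splitP (i : 'I_(1 + n)).
  rewrite (_ : (fun _ => _) = fst)//; apply/funext => -[t v] /=.
  have -> : i = lshift n j by exact: val_inj.
  by rewrite (@row_mxEl R 1 1 n) ord1 mxE eqxx mulr1n.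
rewrite (_ : (fun _ => _) = (fun v : 'rV[R]_n => v 0 j) \o snd).
  by apply: measurableT_comp => //; exact: measurable_coord.
apply/funext => -[t v] /=.
have -> : i = rshift 1 j by exact: val_inj.
by rewrite (@row_mxEr R 1 1 n).
Qed.

Lemma measurable_rV_uncons n : measurable_fun setT (@rV_uncons n).
Proof.
apply/measurable_fun_pairP; split; first exact: measurable_coord.
apply: measurable_fun_rV => i.
rewrite (_ : (fun _ => _) = (fun v : 'rV[R]_n.+1 => v 0 (lift ord0 i))).
  exact: measurable_coord.
by apply/funext => v /=; rewrite mxE.
Qed.

Lemma lebesgue_rV_bundle n :
  exists mu : {sigma_finite_measure set 'rV[R]_n -> \bar R},
    @lebesgue_rV n = mu :> (set 'rV[R]_n -> \bar R).
Proof.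
elim: n => [|n [mu IH]] /=.
  by exists (@dirac _ 'rV[R]_0 0 R).
rewrite IH; set nu := pushforward _ _.
have mC := @measurable_rV_cons n; have mU := @measurable_rV_uncons n.
pose nuM : {measure set 'rV[R]_n.+1 -> \bar R} :=
  measure_function_pushforward__canonical__measure_function_Measure
    (lebesgue_R \x mu)%E mC.
have sf : sigma_finite setT nuM.
  have /sigma_finiteP[F [FT ndF Foo]] := sigma_finiteT lebesgue_R.
  have /sigma_finiteP[G [GT ndG Goo]] := sigma_finiteT mu.
  exists (fun k => (@rV_uncons n) @^-1` (F k `*` G k)).
    rewrite -preimage_bigcup (_ : \bigcup_k _ = setT) ?preimage_setT//.
    apply/seteqP; split => // -[x y] _.
    have [k _ Fkx] : (\bigcup_k F k) x by rewrite -FT.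
    have [l _ Gly] : (\bigcup_k G k) y by rewrite -GT.
    exists (maxn k l) => //; split.
    - by move: x Fkx; exact/subsetPset/ndF/leq_maxl.
    - by move: y Gly; exact/subsetPset/ndG/leq_maxr.
  move=> k; have [mF Fk] := Foo k; have [mG Gk] := Goo k; split.
    by rewrite -[X in measurable X]setTI; apply: mU => //; exact: measurableX.
  rewrite /nuM /= /pushforward -comp_preimage.
  rewrite (_ : _ \o _ = id) ?preimage_id; last first.
    by apply/funext => z /=; rewrite rV_consK.
  by rewrite product_measure1E// lte_mul_pinfty// ge0_fin_numE.
pose sfM := Measure_isSigmaFinite.Build _ _ _ nuM sf.
pose nuS : {sigma_finite_measure set 'rV[R]_n.+1 -> \bar R} :=
  HB.pack nu (Measure.class nuM) sfM.
by exists (nuS mC).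
Qed.

Section lebesgue_rV_instances.
Variable n : nat.

Let rV0 : @lebesgue_rV n set0 = 0%E.
Proof. by have [mu ->] := lebesgue_rV_bundle n. Qed.

Let rV_ge0 (A : set 'rV[R]_n) : (0 <= @lebesgue_rV n A)%E.
Proof. by have [mu ->] := lebesgue_rV_bundle n. Qed.

Let rV_sigma_additive : semi_sigma_additive (@lebesgue_rV n).
Proof.
by have [mu ->] := lebesgue_rV_bundle n; exact: measure_semi_sigma_additive.
Qed.

HB.instance Definition _ := isMeasure.Build _ 'rV[R]_n R (@lebesgue_rV n)
  rV0 rV_ge0 rV_sigma_additive.

Let rV_sigma_finite : sigma_finite setT (@lebesgue_rV n).
Proof. by have [mu ->] := lebesgue_rV_bundle n; exact: sigma_finiteT. Qed.

HB.instance Definition _ := Measure_isSigmaFinite.Build _ _ _ (@lebesgue_rV n)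
  rV_sigma_finite.

End lebesgue_rV_instances.

End lebesgue_rV.
Arguments lebesgue_rV {R} n.

Lemma lebesgue_rV_box (R : realType) n (a b : 'rV[R]_n) : (forall i, a 0 i <= b 0 i) ->
  lebesgue_rV n [set v : 'rV[R]_n | forall i, a 0 i <= v 0 i <= b 0 i] = (\prod_(i < n) (b 0 i - a 0 i))%:E.
Proof.
elim: n a b => [|n IH] a b ab.
  rewrite big_ord0 /= diracE.
  by rewrite mem_set// => -[].
set u := fun w : 'rV[R]_n.+1 => (\row_i w 0 (lift ord0 i) : 'rV[R]_n).
rewrite big_ord_recl /= /pushforward.
rewrite (_ : _ @^-1` _ = `[a 0 0, b 0 0] `*` [set v : 'rV[R]_n | forall i, u a 0 i <= v 0 i <= u b 0 i]).
  rewrite product_measure1E//; last first.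
    rewrite (_ : mkset _ = \big[setI/setT]_(i < n) ((fun v : 'rV[R]_n => v 0 i) @^-1` `[u a 0 i, u b 0 i])).
      apply: bigsetI_measurable => i _. rewrite -[X in measurable X]setTI.
      by apply: measurable_coord => //; exact: measurable_itv.
    rewrite -bigcap_seq; apply/seteqP; split => v /= h i.
      by move=> _ /=; rewrite in_itv/= h.
    by have := h i; rewrite /= in_itv/=; apply; rewrite mem_index_enum.
  rewrite [X in (_ * X)%E](IH (u a) (u b)); last by move=> i; rewrite !mxE.
  have e1 : lebesgue_R `[a 0 0, b 0 0]%classic = (if (a 0 0 < b 0 0)%R then (b 0%R 0%R)%:E - (a 0%R 0%R)%:E else 0)%E.
    by rewrite -lte_fin; exact: (lebesgue_measure_itv `[a 0 0, b 0 0]).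
  rewrite EFinM [X in (X * _)%E](_ : _ = (if (a 0%R 0%R < b 0%R 0%R)%R then (b 0%R 0%R)%:E - (a 0%R 0%R)%:E else 0)%E); last exact: e1.
  have -> : (if (a 0 0 < b 0 0)%R then (b 0%R 0%R)%:E - (a 0%R 0%R)%:E else 0)%E = (b 0 0 - a 0 0)%:E.
    have := ab 0; rewrite le_eqVlt => /orP[/eqP ->|->]; last by rewrite EFinB.
    by rewrite ltxx subrr.
  by congr (_ * _%:E)%E; apply: eq_bigr => i _; rewrite !mxE.
have c0 (t : R) (v : 'rV[R]_n) : rV_cons (t, v) 0 ord0 = t.
  by have /(congr1 fst) := @rV_consK R n (t, v).
have cS (t : R) (v : 'rV[R]_n) i : rV_cons (t, v) 0 (lift ord0 i) = v 0 i.
  have /(congr1 (fun z : R * 'rV[R]_n => z.2 0 i)) := @rV_consK R n (t, v).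
  by rewrite /rV_uncons /= mxE.
apply/seteqP; split => -[t v] /=.
  move=> h; split; first by have := h ord0; rewrite in_itv/= c0.
  by move=> i; have := h (lift ord0 i); rewrite cS /u !mxE.
move=> [h1 h2] i; have [j ->|->] := unliftP ord0 i.
  by have := h2 j; rewrite cS /u !mxE.
by rewrite c0; rewrite in_itv in h1.
Qed.

(* Points x = (s, p) of R^d = R^(d-1) x R *)
Notation Rspace R d := ('rV[R]_d.-1 * R)%type.

Definition lebesgue_space (R : realType) (d : nat) : set (Rspace R d) -> \bar R :=
  (lebesgue_rV d.-1 \x @lebesgue_R R)%E.

HB.instance Definition _ (R : realType) (d : nat) :=
  Measure.on (@lebesgue_space R d).

Arguments lebesgue_space {R d}.

Definition boundary (T : topologicalType) (A : set T) : set T :=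
  closure A `\` interior A.

Section cost.
Context (R : realType) (d : nat).
Local Notation E := (Rspace R d).
Implicit Types (B : set 'rV[R]_d.-1) (X Y : set E) (c : E -> E -> R).

Definition column B : set E := [set x | B x.1 /\ 0 <= x.2].

Definition truncated_column B (P : R) : set E := [set x | B x.1 /\ 0 <= x.2 <= P].

Definition subgraph B (f : 'rV[R]_d.-1 -> R) : set E :=
  [set x | B x.1 /\ 0 <= x.2 <= f x.1].

Definition graph_on B (f : 'rV[R]_d.-1 -> R) : set E :=
  [set (s, f s) | s in B].

Definition locally_lipschitz (V W : normedModType R) (A : set V) (f : V -> W) :=
  forall x, A x ->
    exists2 U : set V, nbhs x U & exists k : R, k.-lipschitz_(U `&` A) f.

Definition nonneg_cost B Y c :=
  forall x y, column B x -> Y y -> 0 <= c x y.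

Definition cost_lipschitz B Y c :=
  locally_lipschitz (column B `*` Y) (fun z : E * E => c z.1 z.2).

Definition cost_increasing B Y c := forall s y, B s -> Y y ->
  (forall p p', 0 <= p -> p < p' -> c (s, p) y < c (s, p') y) /\
  (forall M, exists2 p, 0 <= p & M < c (s, p) y).

(* The family is indexed by the pairs (p, y); points outside B are isolated in
   [subspace B], so the condition only bears on B. *)
Definition cost_equicontinuous B Y c :=
  equicontinuous [set i : R * E | 0 <= i.1 /\ Y i.2]
    (fun i (s : subspace B) => c (s, i.1) i.2 : R).

Definition C1_on (V W : normedModType R) (O : set V) (f : V -> W) :=
  (forall x, O x -> differentiable f x) /\
  (forall v x, O x -> {for x, continuous (fun z => 'D_v f z)}).

Definition gradient (f : E -> R) (x : E) : E :=
  (\row_i 'D_((delta_mx 0 i, 0) : E) f x, 'D_((0, 1) : E) f x).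

(* needed because the norm of 'rV[R]_n and of product types is the sup norm *)
Definition euclidean_norm (v : E) : R :=
  Num.sqrt (\sum_i (v.1 0 i) ^+ 2 + v.2 ^+ 2).

Definition extended_twist B Y c :=
  exists (OX OY : set E) (chat : E -> E -> R),
    [/\ open OX, open OY, column B `<=` OX & Y `<=` OY] /\
    (forall x y, column B x -> Y y -> chat x y = c x y) /\
    C1_on (OX `*` OY) (fun z : E * E => chat z.1 z.2) /\
    (forall x0, OX x0 -> {in OY &, injective (fun y => gradient (chat^~ y) x0)}) /\
    (exists2 l : R, 0 < l & forall x0 y, OX x0 -> Y y ->
       l <= euclidean_norm (gradient (chat^~ y) x0)).

End cost.

Section transport.
Context (R : realType) (d : nat).
Local Notation E := (Rspace R d).
Local Notation Leb := (@lebesgue_space R d).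
Implicit Types (B : set 'rV[R]_d.-1) (D X Y Z : set E) (c : E -> E -> R).

Definition atomic n (y : 'I_n -> E) (m : 'I_n -> R) : set E -> \bar R :=
  fun A => (\sum_(i < n) (m i)%:E * \d_(y i) A)%E.

(* All first marginals are restrictions of Lebesgue measure to a set D. *)
Definition coupling D (nu : set E -> \bar R)
    (g : {measure set (E * E)%type -> \bar R}) :=
  forall A, measurable A ->
    g (A `*` setT) = Leb (A `&` D) /\ g (setT `*` A) = nu A.

Definition ac_density B (f : 'rV[R]_d.-1 -> R) :=
  [/\ measurable_fun B f, forall s, B s -> 0 <= f s &
      (\int[lebesgue_rV d.-1]_(s in B) (f s)%:E = 1)%E].

Definition energy B Y c (nu : set E -> \bar R) (f : 'rV[R]_d.-1 -> R) : \bar R :=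
  ereal_inf [set (\int[g]_(z in column B `*` Y) (c z.1 z.2)%:E)%E |
             g in coupling (subgraph B f) nu].

Definition minimises B Y c nu (f : 'rV[R]_d.-1 -> R) :=
  ac_density B f /\
  forall g, ac_density B g -> (energy B Y c nu f <= energy B Y c nu g)%E.

Definition continuous_minimiser B Y c nu (f : 'rV[R]_d.-1 -> R) :=
  {within B, continuous f} /\ minimises B Y c nu f.

(* The minimiser is unique almost everywhere; it determines a function on B
   when its continuous density is unique. *)
Definition unique_continuous_minimiser B Y c nu (f : 'rV[R]_d.-1 -> R) :=
  continuous_minimiser B Y c nu f /\
  forall g, continuous_minimiser B Y c nu g -> {in B, g =1 f}.

(* The inverse of p |-> c ((s, p), y) at sigma: under the standing assumptions the
   set has exactly one element when c (s, 0) y <= sigma. *)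
Definition level_height c (s : 'rV[R]_d.-1) (y : E) (sigma : R) : R :=
  if c (s, 0) y <= sigma
  then xget 0 [set p | 0 <= p /\ c (s, p) y = sigma] else 0.

(* The functions max_(y in Y) q(s, y, psi(y) + tau) that are densities on B; the
   density condition determines tau from psi. *)
Definition density_family B Y c : set ('rV[R]_d.-1 -> R) :=
  [set f | exists2 psi : E -> R, {within Y, continuous psi} &
     exists tau : R,
       (forall s, f s = sup [set level_height c s y (psi y + tau) | y in Y]) /\
       ac_density B f].

Definition cost_ext c (yext : E) : E -> E -> R :=
  fun x y => if y == yext then 0 else c x y.

Definition ctransform c Z (phi : E -> R) (x : E) : R :=
  inf [set c x y - phi y | y in Z].

Definition dual_value D Z c (nu : {measure set E -> \bar R}) (phi : E -> R) :=
  (\int[Leb]_(x in D) (ctransform c Z phi x)%:E +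
   \int[nu]_(y in Z) (phi y)%:E)%E.

Definition kantorovich_potential D Z c (nu : {measure set E -> \bar R})
    (phi : E -> R) :=
  {within Z, continuous phi} /\
  forall phi', {within Z, continuous phi'} ->
    (dual_value D Z c nu phi' <= dual_value D Z c nu phi)%E.

Definition laguerre_cell D c k (y : 'I_k -> E) (Psi : 'I_k -> R) (i : 'I_k) :
    set E :=
  [set x | D x /\ forall j, c x (y i) - Psi i <= c x (y j) - Psi j].

Definition transport_map D Y (nu : set E -> \bar R) (T : E -> E) :=
  [/\ measurable_fun D T, {ae Leb, forall x, D x -> Y (T x)} &
      forall A, measurable A -> Leb (D `&` T @^-1` A) = nu A].

Definition optimal_transport_map D Y c nu (T : E -> E) :=
  transport_map D Y nu T /\
  forall T', transport_map D Y nu T' ->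
    (\int[Leb]_(x in D) (c x (T x))%:E <= \int[Leb]_(x in D) (c x (T' x))%:E)%E.

(* y_1, ..., y_n, y_ext: the last index ord_max is mapped to y_ext. *)
Definition add_point n (y : 'I_n -> E) (yext : E) : 'I_n.+1 -> E :=
  fun i => oapp y yext (unlift ord_max i).

End transport.

(* Main.v *)
Require Import Defs.
From HB Require Import structures.
From mathcomp Require Import all_boot all_order all_algebra.
From mathcomp Require Import all_classical all_reals all_analysis.
From mathcomp Require Import measurable_realfun.
From mathcomp Require Import ring lra.

Set Implicit Arguments.
Unset Strict Implicit.
Unset Printing Implicit Defensive.
Import Order.TTheory GRing.Theory Num.Theory.
Import numFieldNormedType.Exports.

Local Open Scope classical_set_scope.
Local Open Scope ring_scope.

(** Call s_i = Psi_i - Psi_(n+1) the price of y_i. Normalising the price of y_ext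
    to 0, the last cell L_(n+1) consists of the points of B x [0, P] at which every
    target y_i costs at least its price. As the cost increases with the height p,
    this is the part of B x [0, P] on or above the graph of
    h(s) = max_j q(s, y_j, s_j), the function called height below. The points just below
    that graph are outside L_(n+1), so the first claim follows from pbar = h on B.

    Masses of the cells. Perturbing the potential by a small bump at y_k shows that
    the mass which nu_ext gives to y_k is at most the volume of L_k
    (potential_atom_le); perturbing it by constants shows that nu_ext and B x [0, P]
    have the same mass P (potential_mass), which forces the volume of B to be 1.
    Two cells overlap in a null set: for two targets in Y, the twist condition says
    that the gradients of their costs differ in some coordinate, and the points of
    equality are then isolated on the lines in that coordinate (tie_null); for
    a target in Y and y_ext, monotonicity in p suffices (level_null). Hence all the
    inequalities are equalities, and L_i has volume m_i (laguerre_mass).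

    The height is a density below P. The volume of L_(n+1) says that min(h, P) has
    integral 1. Lowering all the prices by a suitable t gives a height of integral 1;
    it is one of the functions max_y q(s, y, psi y + tau) (height_density_family),
    so it is smaller than P, and comparison with min(h, P) shows that
    it equals h almost everywhere (truncated_height_density).

    The height minimises the energy. For a coupling of the subgraph of f with nu,
    the cost splits into the prices paid, the integral over the subgraph of the
    surplus min_i (c(x, y_i) - s_i), and a nonnegative gap, which vanishes when
    almost every point goes to a cheapest target (coupling_integral). The surplus is
    negative below the graph of h and nonnegative above it, so the subgraph of h
    minimises its integral among the sets of volume 1 (bathtub). The map T sends
    almost every point to a cheapest target, so h is a continuous minimiser, and
    uniqueness gives h = pbar on B. The same splitting shows that T is optimal, and
    that the gap of any other optimal map vanishes; the latter then agrees with T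
    off the overlaps of the cells. *)

(** * Borel sets of the product spaces *)

(** Every product space below carries a product sigma-algebra and a product
    topology; a countable base made of measurable sets is what makes the open
    sets measurable. The measurable sets are a parameter M, so that one lemma
    passes the property to all the products. *)
Definition measurable_base (T : topologicalType) (M : set (set T)) :=
  exists F : nat -> set T, (forall k, M (F k)) /\
    forall x U, nbhs x U -> exists k, F k x /\ F k `<=` U.

Lemma measurable_base_R (R : realType) : measurable_base (@measurable _ R).
Proof.
pose F (k : nat) : set R :=
  if unpickle k is Some (a, b) then `]ratr a, ratr b[%classic else set0.
exists F; split.
  by move=> k; rewrite /F; case: unpickle => [[a b]|//].
move=> x U /nbhs_ballP[e /= e0 eU].
have [a] : exists a : rat, ratr a \in `](x - e), x[ by apply: rat_in_itvoo; lra.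
have [b] : exists b : rat, ratr b \in `]x, (x + e)[ by apply: rat_in_itvoo; lra.
rewrite !in_itv/= => /andP[xb be] /andP[ea ax].
exists (pickle (a, b)); rewrite /F pickleK /= in_itv/= xb ax; split => // z /=.
rewrite in_itv/= => /andP[az zb]; apply: eU; rewrite /ball/=.
by rewrite ltr_distlC; apply/andP; split; lra.
Qed.

Lemma measurable_base_prod (T1 T2 : topologicalType) (M1 : set (set T1))
    (M2 : set (set T2)) (M : set (set (T1 * T2))) :
  (forall A1 A2, M1 A1 -> M2 A2 -> M (A1 `*` A2)) ->
  measurable_base M1 -> measurable_base M2 -> measurable_base M.
Proof.
move=> M12 [F1 [mF1 F1b]] [F2 [mF2 F2b]].
pose G (ab : nat * nat) := F1 ab.1 `*` F2 ab.2.
pose F k := G (if unpickle k is Some ab then ab else (0%N, 0%N)).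
exists F; split; first by move=> k; exact: M12.
move=> [x1 x2] U [[U1 U2] /= [xU1 xU2] U12].
have [k1 [F1x F1U]] := F1b _ _ xU1; have [k2 [F2x F2U]] := F2b _ _ xU2.
exists (pickle (k1, k2)); rewrite /F pickleK /G /=; split => // -[z1 z2] [/= z1F z2F].
by apply: U12; split => /=; [exact: F1U|exact: F2U].
Qed.

Lemma measurable_base_rV (R : realType) n :
  measurable_base (@measurable _ 'rV[R]_n).
Proof.
pose box (ab : 'rV[rat]_n * 'rV[rat]_n) : set 'rV[R]_n :=
  [set v | forall i, v 0 i \in `](ratr (ab.1 0 i)), (ratr (ab.2 0 i))[].
pose F (k : nat) := if unpickle k is Some ab then box ab else set0.
have mbox ab : measurable (box ab).
  rewrite (_ : box ab = \big[setI/setT]_(i < n)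
      ((fun v : 'rV[R]_n => v 0 i) @^-1`
        `](ratr (ab.1 0 i)), (ratr (ab.2 0 i))[)).
    apply: bigsetI_measurable => i _; rewrite -[X in measurable X]setTI.
    by apply: measurable_coord => //; exact: measurable_itv.
  rewrite -bigcap_seq; apply/seteqP; split => v /= h i; first by move=> _; exact: h.
  by apply: h; rewrite /= mem_index_enum.
exists F; split; first by move=> k; rewrite /F; case: unpickle.
move=> x U /nbhs_ballP[e /= e0 eU].
have ha i : {a : rat | (ratr a : R) \in `](x 0 i - e), (x 0 i)[}.
  by apply: cid; apply: rat_in_itvoo; lra.
have hb i : {b : rat | (ratr b : R) \in `](x 0 i), (x 0 i + e)[}.
  by apply: cid; apply: rat_in_itvoo; lra.
exists (pickle (\row_i sval (ha i), \row_i sval (hb i))).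
rewrite /F pickleK /box /=; split.
  move=> i; rewrite !mxE; move: (svalP (ha i)) (svalP (hb i)).
  by rewrite !in_itv/= => /andP[_ ->] /andP[->].
move=> v vi; apply: eU; split => // i j; rewrite ord1.
have := vi j; move: (svalP (ha j)) (svalP (hb j)); rewrite !mxE !in_itv/=.
move=> /andP[h1 h2] /andP[h3 h4] /andP[h5 h6].
by rewrite /ball/= ltr_distlC; apply/andP; split; lra.
Qed.

Section borel_prod.
Context (R : realType).

Lemma open_bigcup_base (T : topologicalType) (M : set (set T)) (U : set T) :
  M set0 -> (forall G : nat -> set T, (forall k, M (G k)) -> M (\bigcup_k G k)) ->
  measurable_base M -> open U -> M U.
Proof.
move=> M0 MU [F [mF bF]] oU.
pose G k := if pselect (F k `<=` U) then F k else set0.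
rewrite (_ : U = \bigcup_k G k).
  by apply: MU => k; rewrite /G; case: pselect => ? /=; [exact: mF|exact: M0].
apply/seteqP; split => x.
  move=> Ux; have [k [Fx FU]] := bF _ _ (open_nbhs_nbhs (conj oU Ux)).
  by exists k => //; rewrite /G; case: pselect.
by move=> [k _]; rewrite /G; case: pselect => // FU; exact: FU.
Qed.

Lemma measurable_base_space d : measurable_base (@measurable _ (Rspace R d)).
Proof.
apply: measurable_base_prod (@measurable_base_rV R d.-1) (@measurable_base_R R).
by move=> A1 A2 mA1 mA2; exact: measurableX.
Qed.

Lemma open_measurable_rV n (U : set 'rV[R]_n) : open U -> measurable U.
Proof.
move=> oU; apply: (open_bigcup_base _ _ (@measurable_base_rV R n) oU).
  exact: measurable0.
by move=> G mG; exact: bigcupT_measurable.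
Qed.

Lemma open_measurable_space d (U : set (Rspace R d)) : open U -> measurable U.
Proof.
move=> oU; apply: (open_bigcup_base _ _ (@measurable_base_space d) oU).
  exact: measurable0.
by move=> G mG; exact: bigcupT_measurable.
Qed.

Lemma open_measurable_space2 d (U : set (Rspace R d * Rspace R d)) :
  open U -> measurable U.
Proof.
move=> oU; have b := @measurable_base_space d.
have b2 : measurable_base (@measurable _ (Rspace R d * Rspace R d)%type).
  apply: (measurable_base_prod _ b b) => A1 A2 mA1 mA2; exact: measurableX.
apply: (open_bigcup_base _ _ b2 oU); first exact: measurable0.
by move=> G mG; exact: bigcupT_measurable.
Qed.

End borel_prod.

Section borel_functions.
Context (R : realType) (d : nat).
Local Notation E := (Rspace R d).

Lemma near_open_within (T : topologicalType) (M : set (set T)) (D U : set T) :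
  (forall O, open O -> M O) -> (forall A A', M A -> M A' -> M (A `&` A')) ->
  M D -> (forall x, D x -> U x -> \forall z \near x, D z -> U z) ->
  M (D `&` U).
Proof.
move=> Mo MI MD DU.
rewrite (_ : _ `&` _ = D `&` interior [set z | D z -> U z]).
  by apply: MI => //; apply: Mo; exact: open_interior.
apply/seteqP; split => x [Dx] Ux; split => //; first exact: DU.
by have /= := interior_subset Ux; exact.
Qed.

Lemma measurable_near_rV n (D U : set 'rV[R]_n) : measurable D ->
  (forall x, D x -> U x -> \forall z \near x, D z -> U z) ->
  measurable (D `&` U).
Proof.
move=> mD; apply: near_open_within => //.
  by move=> O; exact: open_measurable_rV.
by move=> ? ?; exact: measurableI.
Qed.

Lemma measurable_near_space (D U : set E) : measurable D ->
  (forall x, D x -> U x -> \forall z \near x, D z -> U z) ->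
  measurable (D `&` U).
Proof.
move=> mD; apply: near_open_within => //.
  by move=> O; exact: open_measurable_space.
by move=> ? ?; exact: measurableI.
Qed.

Lemma measurable_near_space2 (D U : set (E * E)) : measurable D ->
  (forall x, D x -> U x -> \forall z \near x, D z -> U z) ->
  measurable (D `&` U).
Proof.
move=> mD; apply: near_open_within => //.
  by move=> O; exact: open_measurable_space2.
by move=> ? ?; exact: measurableI.
Qed.

Lemma closed_measurable_rV n (D : set 'rV[R]_n) : closed D -> measurable D.
Proof.
by move=> cD; rewrite -(setCK D); apply: measurableC; apply: open_measurable_rV;
  exact: closed_openC.
Qed.

Lemma closed_measurable_space (D : set E) : closed D -> measurable D.
Proof.
by move=> cD; rewrite -(setCK D); apply: measurableC; apply: open_measurable_space;
  exact: closed_openC.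
Qed.

Lemma compact_closed_rV n (D : set 'rV[R]_n) : compact D -> closed D.
Proof. by apply: compact_closed; exact: norm_hausdorff. Qed.

Lemma compact_closed_space (D : set E) : compact D -> closed D.
Proof. by apply: compact_closed; exact: norm_hausdorff. Qed.

Lemma measurable_fun_sublevel d' (T : measurableType d') (D : set T) (f : T -> R) :
  measurable D -> (forall a, measurable (D `&` [set x | f x < a])) ->
  measurable_fun D f.
Proof.
move=> mD mf; apply: (measurability _ (measurable_realfun.RGenInftyO.measurableE R)).
move=> _ [_ [a ->] <-]; rewrite (_ : _ @^-1` _ = [set x | f x < a])//.
Qed.

Lemma within_near (T : topologicalType) (D : set T) (f : T -> R) (O : set R) x :
  {within D, continuous f} -> open O -> D x -> O (f x) ->
  \forall z \near x, D z -> O (f z).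
Proof.
move=> /subspace_continuousP cf oO Dx Ofx.
by have /cf := Dx; move=> /(_ O (open_nbhs_nbhs (conj oO Ofx))).
Qed.

Lemma within_measurable_rV n (D : set 'rV[R]_n) (f : 'rV[R]_n -> R) :
  measurable D -> {within D, continuous f} -> measurable_fun D f.
Proof.
move=> mD cf; apply: measurable_fun_sublevel => // a.
apply: measurable_near_rV => // x Dx fx.
by apply: (@within_near _ _ f [set t | t < a]) => //; exact: open_lt.
Qed.

Lemma within_measurable_space (D : set E) (f : E -> R) :
  measurable D -> {within D, continuous f} -> measurable_fun D f.
Proof.
move=> mD cf; apply: measurable_fun_sublevel => // a.
apply: measurable_near_space => // x Dx fx.
by apply: (@within_near _ _ f [set t | t < a]) => //; exact: open_lt.
Qed.

Lemma within_measurable_space2 (D : set (E * E)) (f : E * E -> R) :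
  measurable D -> {within D, continuous f} -> measurable_fun D f.
Proof.
move=> mD cf; apply: measurable_fun_sublevel => // a.
apply: measurable_near_space2 => // x Dx fx.
by apply: (@within_near _ _ f [set t | t < a]) => //; exact: open_lt.
Qed.

End borel_functions.

(** * Sets with discrete sections are Lebesgue-null *)

Section null_sections.
Context (R : realType).
Local Notation E d := (Rspace R d).

Lemma lebesgue_R_countable (S : set R) : countable S -> @lebesgue_R R S = 0%E.
Proof. exact: countable_lebesgue_measure0. Qed.

(** By Fubini, integrating first along the chosen coordinate; the induction peels
    off the coordinates that precede it. *)
Lemma lebesgue_rV_null_sections n (N : set 'rV[R]_n) (i : 'I_n) :
  measurable N ->
  (forall v, countable [set t : R | N (v + t *: delta_mx 0 i)]) ->
  lebesgue_rV n N = 0%E.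
Proof.
elim: n N i => [N [] //|n IH N i mN Ni].
have mN' : measurable ((@rV_cons R n) @^-1` N).
  by rewrite -[X in measurable X]setTI; exact: measurable_rV_cons.
rewrite /= /pushforward; have [j ij|i0] := unliftP ord0 i.
  rewrite /product_measure1 integral0_eq// => t _ /=; apply: (IH _ j).
    exact: measurable_xsection.
  move=> v; apply: sub_countable (Ni (rV_cons (t, v))).
  apply: subset_card_le => u /=; rewrite /xsection/= inE /=.
  congr N; apply/rowP => k; rewrite /rV_cons /= ij !mxE.
  case: splitP => l kl; rewrite ?mxE.
    rewrite (_ : k == _ = false) ?andbF ?mulr0 ?addr0//.
    by apply/negbTE; rewrite -val_eqE /= kl ord1.
  rewrite (_ : (k == _) = (l == j))// -val_eqE /= kl/=.
  by rewrite /bump /= !add1n eqSS.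
have prodE : (@lebesgue_R R \x @lebesgue_rV R n)%E ((@rV_cons R n) @^-1` N) =
    (@lebesgue_R R \x^ @lebesgue_rV R n)%E ((@rV_cons R n) @^-1` N).
  apply: product_measure_unique => //= A B mA mB.
  exact: product_measure2E.
rewrite prodE /product_measure2 integral0_eq// => v _ /=.
apply: lebesgue_R_countable.
apply: sub_countable (Ni (rV_cons (0, v))); apply: subset_card_le => u /=.
rewrite /ysection/= inE /=.
congr N; apply/rowP => k; rewrite /rV_cons /= i0 !mxE.
case: splitP => l kl; rewrite ?mxE.
  rewrite ord1 eqxx (_ : k == _); first by rewrite !mulr1n mulr1 add0r.
  by rewrite -val_eqE /= kl ord1.
rewrite (_ : k == _ = false) ?andbF ?mulr0 ?addr0//.
by apply/negbTE; rewrite -val_eqE /= kl.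
Qed.

Lemma lebesgue_space_null_sections1 d (N : set (E d)) (i : 'I_d.-1) :
  measurable N ->
  (forall x : E d, countable [set t : R | N (x + t *: (delta_mx 0 i, 0))]) ->
  lebesgue_space N = 0%E.
Proof.
move=> mN Ni; have -> : lebesgue_space N = (@lebesgue_rV R d.-1 \x^ @lebesgue_R R)%E N.
  apply: product_measure_unique => //= A B mA mB; exact: product_measure2E.
rewrite /product_measure2 integral0_eq// => p _ /=.
apply: (@lebesgue_rV_null_sections _ _ i); first exact: measurable_ysection.
move=> v; apply: sub_countable (Ni (v, p)); apply: subset_card_le => u /=.
rewrite /ysection/= inE /=; congr N; congr pair => /=.
by rewrite [X in p + X]mulr0 addr0.
Qed.

Lemma lebesgue_space_null_sections2 d (N : set (E d)) :
  measurable N -> (forall s, countable [set p : R | N (s, p)]) ->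
  lebesgue_space N = 0%E.
Proof.
move=> mN Ni; rewrite /lebesgue_space /product_measure1 integral0_eq// => s _ /=.
apply: lebesgue_R_countable; apply: sub_countable (Ni s).
by apply: subset_card_le => p /=; rewrite /xsection/= inE.
Qed.

End null_sections.

(** * First-order conditions on a Kantorovich potential *)

Section potential.
Context (R : realType) (d : nat).
Local Notation E := (Rspace R d).
Local Notation Leb := (@lebesgue_space R d).
Variables (D Z : set E) (c : E -> E -> R) (nu : {measure set E -> \bar R}).
Variables (z0 : E) (C : R).
Hypotheses (mD : measurable D) (LebD : (Leb D < +oo)%E).
Hypotheses (Z_compact : compact Z) (nuZ : (nu Z < +oo)%E).
Hypothesis c_ge0 : forall x y, D x -> Z y -> 0 <= c x y.
Hypothesis c_cont1 : forall y, Z y -> {within D, continuous (c^~ y)}.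
Hypothesis c_cont2 : forall x, D x -> {within Z, continuous (c x)}.
Hypotheses (Zz0 : Z z0) (c_z0 : forall x, D x -> c x z0 <= C).

Lemma within_compact_bounded (phi : E -> R) :
  {within Z, continuous phi} -> exists M, forall y, Z y -> `|phi y| <= M.
Proof.
move=> /continuous_compact/(_ Z_compact)/compact_bounded[M [_ MZ]].
exists (M + 1) => y Zy; apply: (MZ (M + 1)); first by rewrite ltrDl.
by exists y.
Qed.

Lemma ctransform_le (phi : E -> R) x y : {within Z, continuous phi} ->
  D x -> Z y -> ctransform c Z phi x <= c x y - phi y.
Proof.
move=> /within_compact_bounded[M phiM] Dx Zy; apply: ge_inf; last by exists y.
exists (- M) => _ [y' Zy' <-]; have := c_ge0 Dx Zy'.
by have := phiM _ Zy'; rewrite ler_norml => /andP[_]; lra.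
Qed.

Lemma ctransform_ge (phi : E -> R) x a :
  (forall y, Z y -> a <= c x y - phi y) -> a <= ctransform c Z phi x.
Proof.
move=> h; apply: lb_le_inf; first by exists (c x z0 - phi z0); exists z0.
by move=> _ [y Zy <-]; exact: h.
Qed.

Lemma measurable_ctransform (phi : E -> R) : {within Z, continuous phi} ->
  measurable_fun D (ctransform c Z phi).
Proof.
move=> cphi; apply: measurable_fun_sublevel => // a.
apply: measurable_near_space => // x Dx xa.
have [y Zy ya] : exists2 y, Z y & c x y - phi y < a.
  apply: contrapT => h; move: xa; apply/negP; rewrite -leNgt.
  apply: ctransform_ge => y Zy; rewrite leNgt; apply/negP => ya.
  by apply: h; exists y.
have : c x y < a + phi y by lra.
move=> /(within_near (O := [set t | t < a + phi y]) (c_cont1 Zy) _ Dx).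
move=> /(_ (@open_lt _ _)); apply: filterS => z + Dz => /(_ Dz)/= cz.
by apply: le_lt_trans (ctransform_le cphi Dz Zy) _; lra.
Qed.

Lemma integrable_ctransform (phi : E -> R) : {within Z, continuous phi} ->
  Leb.-integrable D (EFin \o ctransform c Z phi).
Proof.
move=> cphi; apply: measurable_bounded_integrable => //.
  exact: measurable_ctransform.
have [M phiM] := within_compact_bounded cphi.
exists (`|M| + `|C|); split; first exact: num_real.
move=> K MK x Dx /=; apply: le_trans (ltW MK); rewrite ler_norml; apply/andP; split.
  apply: ctransform_ge => y Zy; have := c_ge0 Dx Zy; have := phiM _ Zy.
  rewrite ler_norml => /andP[_]; have := ler_norm M; have := normr_ge0 C; lra.
apply: le_trans (ctransform_le cphi Dx Zz0) _; have := c_z0 Dx; have := phiM _ Zz0.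
by rewrite ler_norml => /andP[+ _]; have := ler_norm M; have := ler_norm C; lra.
Qed.

Lemma integrable_within (phi : E -> R) : {within Z, continuous phi} ->
  nu.-integrable Z (EFin \o phi).
Proof.
move=> cphi; have mZ : measurable Z.
  by apply: closed_measurable_space; exact: compact_closed_space.
apply: measurable_bounded_integrable => //; first exact: within_measurable_space.
have [M phiM] := within_compact_bounded cphi.
exists M; split; first exact: num_real.
by move=> K MK x Zx /=; apply: le_trans (phiM _ Zx) (ltW MK).
Qed.

Variable psi : E -> R.
Hypothesis psi_potential : kantorovich_potential D Z c nu psi.

Let mZ : measurable Z.
Proof.
by apply: closed_measurable_space; exact: compact_closed_space.
Qed.

Let psi_cont : {within Z, continuous psi}. Proof. by case: psi_potential. Qed.

Let within_addr (g : E -> R) :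
  {within Z, continuous g} -> {within Z, continuous (psi \+ g)}.
Proof. by move=> cg x; apply: continuousD; [exact: psi_cont|exact: cg]. Qed.

(** The optimality of psi, tested against psi + g: what g gains on nu cannot exceed
    what it costs on the conjugate. *)
Lemma potential_perturbation (g : E -> R) : {within Z, continuous g} ->
  (\int[nu]_(y in Z) (g y)%:E <= \int[Leb]_(x in D)
    (ctransform c Z psi x - ctransform c Z (psi \+ g) x)%:E)%E.
Proof.
move=> cg; have cpg := within_addr cg; have [_ /(_ _ cpg)] := psi_potential.
rewrite /dual_value.
have -> : (\int[nu]_(y in Z) ((psi \+ g) y)%:E =
    \int[nu]_(y in Z) (psi y)%:E + \int[nu]_(y in Z) (g y)%:E)%E.
  by apply: (integralD_EFin mZ); exact: integrable_within.
have -> := integralB_EFin mD (integrable_ctransform psi_cont)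
  (integrable_ctransform cpg).
have := integrable_fin_num mZ (integrable_within cg).
have := integrable_fin_num mZ (integrable_within psi_cont).
have := integrable_fin_num mD (integrable_ctransform cpg).
have := integrable_fin_num mD (integrable_ctransform psi_cont).
do 4 move=> /fineK <-.
by rewrite -!EFinB -!EFinD !lee_fin; lra.
Qed.

(** A constant perturbation t changes the dual value by t (nu Z - Leb D), and t may
    have either sign. *)
Lemma potential_mass : nu Z = Leb D.
Proof.
have shift (t : R) : (t%:E * nu Z <= t%:E * Leb D)%E.
  have ct : {within Z, continuous (cst t : E -> R)} by move=> ?; exact: cst_continuous.
  have h := within_addr ct; rewrite -(integral_cst _ mD) -(integral_cst _ mZ).
  apply: le_trans (potential_perturbation ct) _.
  rewrite le_eqVlt; apply/orP; left; apply/eqP.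
  apply: eq_integral => x /set_mem Dx; congr EFin.
  apply/eqP; rewrite eq_le; apply/andP; split.
    rewrite lerBlDr -lerBlDl; apply: ctransform_ge => y Zy /=.
    by have := ctransform_le psi_cont Dx Zy; lra.
  rewrite lerBrDr; apply: ctransform_ge => y Zy /=.
  by have := ctransform_le h Dx Zy => /=; lra.
apply/eqP; rewrite eq_le; apply/andP; split; first by have := shift 1; rewrite !mul1e.
by have := shift (-1); rewrite !EFinN !mulN1e leeN2.
Qed.

(** The points that z serves under the potential psi. *)
Definition contact_set z := D `&` [set x | c x z - psi z <= ctransform c Z psi x].

Lemma measurable_contact_set z : Z z -> measurable (contact_set z).
Proof.
move=> Zz; rewrite (_ : contact_set z =
    D `&` [set x | 0 <= ctransform c Z psi x - (c x z - psi z)]).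
  apply: measurable_fun_le => //.
  apply: measurable_funB; first exact: measurable_ctransform.
  by apply: measurable_funB => //; apply: within_measurable_space => //; exact: c_cont1.
by apply/seteqP; split => x [Dx /= h]; split => //=; move: h; rewrite subr_ge0.
Qed.

Let bump (z : E) (k : nat) (y : E) : R := k.+1%:R^-1 * Num.max 0 (1 - k.+1%:R * `|y - z|).

Let bump_cont z k : {within Z, continuous (bump z k)}.
Proof.
apply: continuous_subspaceT => y; rewrite /bump.
apply: cvgM; first exact: cvg_cst.
apply: (@continuous_max R E (cst 0) (fun y : E => 1 - k.+1%:R * `|y - z|)); first exact: cvg_cst.
apply: cvgB; first exact: cvg_cst.
apply: cvgM; first exact: cvg_cst.
by apply: cvg_norm; apply: cvgB; [exact: cvg_id|exact: cvg_cst].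
Qed.

Let bump_ge0 z k y : 0 <= bump z k y.
Proof. by rewrite /bump mulr_ge0// le_max lexx. Qed.

Let bump_le z k y : bump z k y <= k.+1%:R^-1.
Proof.
by rewrite /bump ler_piMr// ge_max ler01/= lerBlDr lerDl.
Qed.

Let bump_out z k y : k.+1%:R^-1 <= `|y - z| -> bump z k y = 0.
Proof.
rewrite /bump => h; rewrite (_ : Num.max _ _ = 0) ?mulr0//.
by apply/max_idPl; rewrite subr_le0 -ler_pdivrMl// mulr1.
Qed.

Let cost (z : E) k x := k.+1%:R *
  (ctransform c Z psi x - ctransform c Z (psi \+ bump z k) x).

Let cost_itv z k x : D x -> 0 <= cost z k x <= 1.
Proof.
move=> Dx; have cb := within_addr (@bump_cont z k); apply/andP; split.
  rewrite mulr_ge0// subr_ge0; apply: ctransform_ge => y Zy.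
  apply: le_trans (ctransform_le cb Dx Zy) _.
  by rewrite lerB// lerDl.
rewrite -ler_pdivlMl// mulr1 lerBlDr -lerBlDl; apply: ctransform_ge => y Zy /=.
by rewrite opprD addrA lerB// ?bump_le//; exact: ctransform_le.
Qed.

Let cost_cvg0 z x : Z z -> D x -> ~ contact_set z x ->
  \forall k \near \oo, cost z k x = 0.
Proof.
move=> Zz Dx xNz; have gap : ctransform c Z psi x < c x z - psi z.
  by rewrite ltNge; apply/negP => h; apply: xNz.
pose e := (c x z - psi z - ctransform c Z psi x) / 2.
have e0 : 0 < e by rewrite /e; lra.
have ch : {within Z, continuous (fun y => c x y - psi y)}.
  by move=> y; apply: continuousB; [exact: c_cont2|exact: psi_cont].
have := within_near (O := [set t | c x z - psi z - e < t]) ch.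
move=> /(_ z (@open_gt _ _) Zz); rewrite /= ltrBlDr ltrDl => /(_ e0).
move=> /nbhs_normP[r /= r0 zr].
have near0 (t : R) : 0 < t -> \forall k \near \oo, k.+1%:R^-1 < t.
  by move=> t0; exact: near_infty_natSinv_lt (PosNum t0).
near=> k.
have ke : k.+1%:R^-1 < e by near: k; exact: near0.
have kr : k.+1%:R^-1 < r by near: k; exact: near0.
have /andP[c0 _] := cost_itv z k Dx.
apply/eqP; rewrite eq_le c0 andbT mulr_ge0_le0// subr_le0.
apply: ctransform_ge => y Zy /=; have [yr|ry] := ltP `|y - z| r.
  have := zr y; rewrite /= distrC => /(_ yr Zy) zy.
  rewrite opprD addrA; apply: le_trans (lerB (ltW zy) (le_trans (bump_le z k y) (ltW ke))).
  by rewrite /e; lra.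
rewrite bump_out ?addr0; first exact: ctransform_le.
by apply: le_trans ry; exact: ltW.
Unshelve. all: by end_near. Qed.

(** Adding to psi a bump of height and radius 1/k at z gains at least nu {z}/k in
    the integral against nu, and costs at most 1/k in the other one, only at the
    points where the bump is felt. Any other point than those of the contact set
    stops feeling it when k is large. *)
Lemma potential_atom_le z : Z z -> (nu [set z] <= Leb (contact_set z))%E.
Proof.
move=> Zz; have mL := measurable_contact_set Zz.
have mz : measurable [set z].
  by apply: closed_measurable_space; apply: compact_closed_space; exact: compact_set1.
have mcost k : measurable_fun D (cost z k).
  apply: measurable_funM; first exact: measurable_cst.
  apply: measurable_funB; apply: measurable_ctransform => //.
  by apply: within_addr; exact: bump_cont.
have mDL : measurable (D `\` contact_set z) by exact: measurableD.
have LD : contact_set z `<=` D by move=> x [].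
(* The cost is at most 1 on the contact set and tends to 0 off it. *)
have step k : (nu [set z] <= Leb (contact_set z) +
    \int[Leb]_(x in D `\` contact_set z) (cost z k x)%:E)%E.
  have k0 : (0 < k.+1%:R :> R) by [].
  apply: (@le_trans _ _ (\int[Leb]_(x in D) (cost z k x)%:E)%E); last first.
    rewrite -[X in (integral _ X _ <= _)%E](setDUK LD) ge0_integral_setU//.
    - apply: leeD2r; rewrite -[leRHS]mul1e -(integral_cst _ mL).
      apply: ge0_le_integral => //.
      + by move=> x [Dx _]; rewrite lee_fin; have /andP[] := cost_itv z k Dx.
      + by apply/measurable_EFinP; exact: measurable_funS (mcost k).
      + by move=> x [Dx _]; rewrite lee_fin; have /andP[] := cost_itv z k Dx.
    - by rewrite setDUK//; apply/measurable_EFinP.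
    - move=> x; rewrite setDUK// => Dx.
      by rewrite lee_fin; have /andP[] := cost_itv z k Dx.
    - by apply/disj_setPS; rewrite setDIK.
  have -> : (\int[Leb]_(x in D) (cost z k x)%:E = k.+1%:R%:E * \int[Leb]_(x in D)
      (ctransform c Z psi x - ctransform c Z (psi \+ bump z k) x)%:E)%E.
    rewrite -ge0_integralZl//.
    - apply/measurable_EFinP; apply: measurable_funB; apply: measurable_ctransform => //.
      by apply: within_addr; exact: bump_cont.
    - move=> x Dx; rewrite lee_fin; have /andP[+ _] := cost_itv z k Dx.
      by rewrite pmulr_rge0.
  rewrite -lee_pdivrMl//.
  apply: le_trans (potential_perturbation (@bump_cont z k)).
  rewrite -(setIidl (_ : [set z] `<=` Z)); last by move=> ? ->.
  rewrite -integral_indic// -ge0_integralZl//; last first.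
    by apply/measurable_EFinP; exact: measurable_indic.
  apply: ge0_le_integral; first exact: mZ.
  - by move=> y _; rewrite -EFinM lee_fin mulr_ge0// invr_ge0.
  - apply/measurable_EFinP; apply: measurable_funM; first exact: measurable_cst.
    exact: measurable_indic.
  - apply/measurable_EFinP; apply: within_measurable_space => //; exact: bump_cont.
  - move=> y _; rewrite -EFinM lee_fin indicE; case: (boolP (y \in _)) => [|_].
      rewrite inE => ->; rewrite /bump subrr normr0 mulr0 subr0 mulr1.
      by rewrite (max_idPr ler01) mulr1.
    by rewrite mulr0.
have := @dominated_convergence _ _ _ Leb _ mDL (fun k => EFin \o cost z k) (cst 0%E) (cst 1%E).
case.
- by move=> n; apply/measurable_EFinP; exact: measurable_funS (mcost n).
- exact: measurable_cst.
- apply: aeW => x [Dx xL]; apply: cvg_near_cst.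
  have := cost_cvg0 Zz Dx xL; by apply: filterS => k /= ->.
- apply: (@measurable_bounded_integrable _ _ _ _ (cst 1)) => //.
    by apply: le_lt_trans LebD; apply: le_measure; rewrite ?inE//; move=> x [].
  by exists 1; split => // M M1 x _ /=; rewrite normr1 ltW.
- apply: aeW => x k [Dx _] /=; rewrite lee_fin; have /andP[c0 c1] := cost_itv z k Dx.
  by rewrite ger0_norm.
move=> _ _; rewrite integral0 => cvg0.
have cvgS : (fun k => Leb (contact_set z) +
    \int[Leb]_(x in D `\` contact_set z) (cost z k x)%:E)%E @ \oo --> Leb (contact_set z).
  rewrite -[X in _ --> X]adde0; apply: cvgeD; [|exact: cvg_cst|exact: cvg0].
  by rewrite fin_num_adde_defl.
by apply: (cvge_ge _ cvgS); apply: nearW; exact: step.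
Qed.

End potential.

(** * The height below which some target is worth its price *)

Section cost.
Context (R : realType) (d : nat).
Local Notation E := (Rspace R d).
Variables (B : set 'rV[R]_d.-1) (Y : set E) (c : E -> E -> R).
Hypothesis c_lipschitz : cost_lipschitz B Y c.

Lemma cost_within_continuous :
  {within column B `*` Y, continuous (fun z : E * E => c z.1 z.2)}.
Proof.
apply/subspace_continuousP => z Az; have [U Uz [k kU]] := c_lipschitz Az.
apply/cvgrPdist_lt => e e0.
have k0 : 0 < `|k| + 1 by rewrite ltr_pwDr.
rewrite near_withinE.
have zb : \forall z' \near z, `|z - z'| < e / (`|k| + 1).
  by apply/nbhs_normP; exists (e / (`|k| + 1)) => //=; rewrite divr_gt0.
near=> z' => Az'; have Uz' : U z' by near: z'.
have /= := kU (z, z') (conj (conj (nbhs_singleton Uz) Az) (conj Uz' Az')).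
move=> /le_lt_trans; apply.
apply: (@le_lt_trans _ _ ((`|k| + 1) * `|z - z'|)).
  by rewrite ler_wpM2r// (le_trans (ler_norm k))// lerDl.
by rewrite mulrC -ltr_pdivlMr//; near: z'.
Unshelve. all: by end_near. Qed.

Lemma cost_cvg (T : Type) (F : set_system T) (FF : Filter F) (x y : T -> E) x0 y0 :
  column B x0 -> Y y0 ->
  (\forall t \near F, column B (x t)) -> (\forall t \near F, Y (y t)) ->
  x @ F --> x0 -> y @ F --> y0 -> c (x t) (y t) @[t --> F] --> c x0 y0.
Proof.
move=> Bx0 Yy0 Bx Yy xx0 yy0.
have /subspace_continuousP/(_ (x0, y0) (conj Bx0 Yy0)) := cost_within_continuous.
apply: cvg_trans; move=> U /=; rewrite nbhs_simpl /=.
rewrite [X in X -> _]/= /within /=.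
move=> xyU.
have xy : (x t, y t) @[t --> F] --> (x0, y0) by exact: (cvg_pair xx0 yy0).
have := xy _ xyU; rewrite /= nbhs_simpl /= => FU.
apply: filterS3 FU Bx Yy => t FUt Bt Yt. exact: FUt.
Qed.

Let cvg_space (T : Type) (F : set_system T) (FF : Filter F)
    (s_ : T -> 'rV[R]_d.-1) (p_ : T -> R) s p :
  s_ @ F --> s -> p_ @ F --> p -> (s_ t, p_ t) @[t --> F] --> ((s, p) : E).
Proof. by move=> h1 h2; exact: (cvg_pair h1 h2). Qed.

Lemma cost_within1 (D : set E) y : D `<=` column B -> Y y ->
  {within D, continuous (c^~ y)}.
Proof.
move=> DB Yy; apply/subspace_continuousP => x Dx; apply: cost_cvg => //.
- exact: DB.
- by rewrite near_withinE; apply: nearW => t /DB.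
- exact: nearW.
- exact: cvg_within.
- exact: cvg_cst.
Qed.

Lemma cost_within2 x : column B x -> {within Y, continuous (c x)}.
Proof.
move=> Bx; apply/subspace_continuousP => y Yy; apply: cost_cvg => //.
- exact: nearW.
- by rewrite near_withinE; exact: nearW.
- exact: cvg_cst.
- exact: cvg_within.
Qed.

Hypothesis c_increasing : cost_increasing B Y c.

Lemma cost_lt s y p q : B s -> Y y -> 0 <= p -> p < q -> c (s, p) y < c (s, q) y.
Proof. by move=> Bs Yy; have [h _] := c_increasing Bs Yy; exact: h. Qed.

Lemma cost_le s y p q : B s -> Y y -> 0 <= p -> p <= q -> c (s, p) y <= c (s, q) y.
Proof.
move=> Bs Yy p0; rewrite le_eqVlt => /orP[/eqP ->//|pq].
by apply: ltW; exact: cost_lt.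
Qed.

Lemma cost_cvg_height (y : E) (s : 'rV[R]_d.-1) (p : R) : B s -> Y y -> 0 <= p ->
  c (s, q) y @[q --> within [set q | 0 <= q] (nbhs p)] --> c (s, p) y.
Proof.
move=> Bs Yy p0; apply: cost_cvg => //.
- by rewrite near_withinE; apply: nearW.
- exact: nearW.
- by apply: cvg_space; [exact: cvg_cst|exact: cvg_within].
- exact: cvg_cst.
Qed.

Variables (n : nat) (y : 'I_n -> E).
Hypothesis yY : forall j, Y (y j).
Implicit Types sg : 'I_n -> R.

(** max_j q(s, y_j, sg_j), as the first height at which no target costs less than
    its level. *)
Definition height sg (s : 'rV[R]_d.-1) : R :=
  inf [set p | 0 <= p /\ forall j, sg j <= c (s, p) (y j)].

Let height_set_neq0 sg s : B s ->
  [set p | 0 <= p /\ forall j, sg j <= c (s, p) (y j)] !=set0.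
Proof.
move=> Bs; have /choice[p pj] j : exists p, 0 <= p /\ sg j < c (s, p) (y j).
  have [_ /(_ (sg j))[p p0 ?]] := c_increasing Bs (yY j).
  by exists p.
exists (\sum_j p j); split.
  by apply: sumr_ge0 => j _; have [] := pj j.
move=> j; have [p0 /ltW/le_trans] := pj j; apply; apply: cost_le => //.
rewrite (bigD1 j)//= lerDl; apply: sumr_ge0 => i _; by have [] := pj i.
Qed.

Let height_set_lb sg s :
  has_lbound [set p | 0 <= p /\ forall j, sg j <= c (s, p) (y j)].
Proof. by exists 0 => p []. Qed.

Lemma height_ge0 sg s : B s -> 0 <= height sg s.
Proof. by move=> Bs; apply: lb_le_inf; [exact: height_set_neq0|move=> p []]. Qed.

(** The condition is closed in p by continuity and upward closed by monotonicity,
    hence the infimum is attained. *)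
Lemma height_leP sg s p : B s -> 0 <= p ->
  height sg s <= p <-> forall j, sg j <= c (s, p) (y j).
Proof.
move=> Bs p0; split; last by move=> pj; apply: ge_inf.
rewrite le_eqVlt => /orP[/eqP hp j|hp j]; last first.
  have [q [q0 qj] qp] : exists2 q, 0 <= q /\ (forall j, sg j <= c (s, q) (y j)) & q < p.
    by move: hp => /(inf_lt (height_set_neq0 sg Bs))[q ? ?]; exists q.
  by apply: le_trans (qj j) _; apply: cost_le => //; exact: ltW.
rewrite leNgt; apply/negP => pj.
have : \forall q \near p, 0 <= q -> c (s, q) (y j) < sg j.
  have := @cost_cvg_height (y j) s p Bs (yY j) p0.
  move=> /cvgr_lt/(_ _ pj); by rewrite near_withinE.
move=> /nbhs_normP[e /= e0 pe].
have [q [q0 qj] qp] : exists2 q, 0 <= q /\ (forall j, sg j <= c (s, q) (y j)) & q < p + e.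
  have := @inf_adherent _ _ e e0 (conj (height_set_neq0 sg Bs) (height_set_lb sg s)).
  by rewrite -/(height sg s) hp.
have pq : p <= q by rewrite -hp; exact: ge_inf.
have cq : c (s, q) (y j) < sg j.
  by apply: pe => //=; rewrite distrC ger0_norm ?subr_ge0// ltrBlDl.
by move: cq; rewrite ltNge qj.
Qed.

Lemma height_gtP sg s p : B s -> 0 <= p ->
  p < height sg s <-> exists j, c (s, p) (y j) < sg j.
Proof.
move=> Bs p0; split.
  move=> ph; apply: contrapT => h; move: ph; apply/negP; rewrite -leNgt.
  apply/(height_leP _ Bs p0) => j; rewrite leNgt; apply/negP => pj.
  by apply: h; exists j.
move=> [j pj]; rewrite ltNge; apply/negP => /(height_leP _ Bs p0)/(_ j).
by rewrite leNgt pj.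
Qed.

Lemma height_ltP sg s p : B s -> 0 < p ->
  height sg s < p <-> forall j, sg j < c (s, p) (y j).
Proof.
move=> Bs p0; split.
  move=> hp j; have h0 := height_ge0 sg Bs.
  have := (height_leP sg Bs h0).1 (lexx _) j.
  by move=> /le_lt_trans; apply; exact: cost_lt.
move=> pj; have : \forall q \near p, 0 <= q -> forall j, sg j < c (s, q) (y j).
  have : \forall q \near within [set q | 0 <= q] (nbhs p), forall j, sg j < c (s, q) (y j).
    apply: filter_forall => j.
    by have := @cost_cvg_height (y j) s p Bs (yY j) (ltW p0); move=> /cvgr_gt/(_ _ (pj j)).
  by rewrite near_withinE.
move=> /nbhs_normP[e /= e0 pe].
pose q := Num.max 0 (p - e / 2).
have q0 : 0 <= q by rewrite /q le_max lexx.
have qp : q < p by rewrite /q gt_max p0/= ltrBlDr ltrDl divr_gt0.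
apply: le_lt_trans (qp); apply/(height_leP _ Bs q0) => j; apply: ltW; apply: pe => //=.
rewrite ger0_norm ?subr_ge0; last exact: ltW.
have : p - e / 2 <= q by rewrite /q le_max lexx orbT.
by lra.
Qed.

(** Sublevel and superlevel conditions on the height are finite conjunctions and
    disjunctions of strict inequalities on the cost, which are stable under small
    perturbations; this gives continuity both in the base point and in the levels. *)
Lemma height_cvg (T : Type) (F : set_system T) (FF : Filter F)
    (sg_ : T -> 'I_n -> R) (s_ : T -> 'rV[R]_d.-1) sg s :
  B s -> (\forall t \near F, B (s_ t)) ->
  s_ @ F --> s -> (forall j, sg_ t j @[t --> F] --> sg j) ->
  height (sg_ t) (s_ t) @[t --> F] --> height sg s.
Proof.
move=> Bs Bs_ ss sgsg; have cc p j : 0 <= p ->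
    c (s_ t, p) (y j) - sg_ t j @[t --> F] --> c (s, p) (y j) - sg j.
  move=> p0; apply: cvgB => //; apply: cost_cvg => //.
  - by apply: filterS Bs_.
  - exact: nearW.
  - by apply: cvg_space => //; exact: cvg_cst.
  - exact: cvg_cst.
have h0 := height_ge0 sg Bs.
apply/cvgrPdist_lt => e e0.
have up : \forall t \near F, height (sg_ t) (s_ t) < height sg s + e.
  have p0 : 0 < height sg s + e by rewrite ltr_wpDl.
  have : \forall t \near F, forall j, 0 < c (s_ t, height sg s + e) (y j) - sg_ t j.
    apply: filter_forall => j; apply: (cvgr_gt _ (cc _ _ (ltW p0))).
    by rewrite subr_gt0; apply: (height_ltP sg Bs p0).1; rewrite ltrDl.
  move=> h; near=> t; apply/height_ltP => //; first exact: (near Bs_ t).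
  by move=> j; rewrite -subr_gt0; exact: (near h t).
have lo : \forall t \near F, height sg s - e < height (sg_ t) (s_ t).
  have [e_lt|p0] := ltP (height sg s - e) 0.
    by near=> t; apply: lt_le_trans e_lt _; apply: height_ge0; exact: (near Bs_ t).
  have /(height_gtP sg Bs p0)[j] : height sg s - e < height sg s by rewrite ltrBlDr ltrDl.
  rewrite -subr_lt0 => /(cvgr_lt _ (cc _ j p0)) h.
  near=> t; apply/height_gtP => //; first exact: (near Bs_ t).
  by exists j; rewrite -subr_lt0; exact: (near h t).
near=> t; rewrite distrC ltr_distl; apply/andP; split; [exact: (near lo t)|exact: (near up t)].
Unshelve. all: by end_near. Qed.

Lemma height_within_continuous sg : {within B, continuous (height sg)}.
Proof.
apply/subspace_continuousP => s Bs; apply: (@height_cvg _ _ _ (fun=> sg)) => //.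
- by rewrite near_withinE; exact: nearW.
- exact: cvg_within.
- by move=> j; exact: cvg_cst.
Qed.

Lemma height_le_homo sg sg' s : B s -> (forall j, sg j <= sg' j) ->
  height sg s <= height sg' s.
Proof.
move=> Bs sgsg'; have h0 := height_ge0 sg' Bs; apply/(height_leP _ Bs h0) => j.
by apply: le_trans (sgsg' j) _; exact: (height_leP _ Bs h0).1.
Qed.

Lemma height_eq0 sg s : B s -> (forall j, sg j <= c (s, 0) (y j)) -> height sg s = 0.
Proof.
move=> Bs sg0; apply/eqP; rewrite eq_le height_ge0// andbT.
exact/(height_leP _ Bs (lexx _)).
Qed.

End cost.

(** * Heights are upper envelopes over all the targets *)

Section density_family.
Context (R : realType) (d : nat).
Local Notation E := (Rspace R d).
Variables (B : set 'rV[R]_d.-1) (Y : set E) (c : E -> E -> R).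
Hypotheses (B_compact : compact B) (Y_neq0 : Y !=set0).
Hypothesis c_ge0 : nonneg_cost B Y c.
Hypothesis c_lipschitz : cost_lipschitz B Y c.
Hypothesis c_increasing : cost_increasing B Y c.
Variables (n : nat) (y : 'I_n -> E) (sg : 'I_n -> R).
Hypothesis yY : forall j, Y (y j).

Let h := height c y sg.

Let colh s : B s -> column B (s, h s).
Proof. by move=> Bs; split => //=; exact: height_ge0 yY _ _ Bs. Qed.

(** A height built on finitely many targets is max_y q(s, y, psi y) over all of Y
    when psi is the following function: with this level no target reaches above
    the height, and the target that determines the height at s keeps its level. *)
Definition graph_cost (z : E) : R := inf [set c (s, h s) z | s in B].

Let graph_cost_le s z : B s -> Y z -> graph_cost z <= c (s, h s) z.
Proof.
move=> Bs Yz; apply: ge_inf; last by exists s.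
by exists 0 => _ [s' Bs' <-]; exact: c_ge0 (colh Bs') Yz.
Qed.

Let graph_cost_ge z a : B !=set0 -> (forall s, B s -> a <= c (s, h s) z) -> a <= graph_cost z.
Proof.
move=> [s0 Bs0] ha; apply: lb_le_inf; first by exists (c (s0, h s0) z), s0.
by move=> _ [s Bs <-]; exact: ha.
Qed.

(** By compactness of B, the functions c (s, h s) are equicontinuous in the target. *)
Lemma graph_cost_continuous : B !=set0 -> {within Y, continuous graph_cost}.
Proof.
move=> B0; apply/subspace_continuousP => z Yz; apply/cvgrPdist_le => e e0.
have : \forall z' \near within Y (nbhs z), B `<=` [set s | `|c (s, h s) z - c (s, h s) z'| <= e].
  apply: (near_covering_withinP _).2; first exact/compact_near_coveringP.
  move=> s Bs.
  have e2 : 0 < e / 2 by rewrite divr_gt0.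
  have hs : h s' @[s' --> within B (nbhs s)] --> h s.
    have /subspace_continuousP := height_within_continuous c_lipschitz c_increasing yY (sg := sg).
    exact.
  pose F := filter_prod (within B (nbhs s)) (within Y (nbhs z)).
  have F1 : t.1 @[t --> F] --> s.
    by apply: (cvg_trans cvg_fst); exact: cvg_within.
  have Fh : h t.1 @[t --> F] --> h s by apply: (cvg_comp _ _ _ hs); exact: cvg_fst.
  have cs (zf : 'rV[R]_d.-1 * E -> E) : (\forall t \near F, Y (zf t)) ->
      zf @ F --> z -> c (t.1, h t.1) (zf t) @[t --> F] --> c (s, h s) z.
    move=> Yzf zfz; apply: (cost_cvg c_lipschitz _ (colh Bs) Yz) => //.
      exists (B, Y) => /=; first by split; exact: withinT.
      by move=> [s' z'] [/= Bs' _]; exact: colh.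
    exact: (cvg_pair F1 Fh).
  have cz1 : c (t.1, h t.1) z @[t --> F] --> c (s, h s) z.
    by apply: (cs (fun=> z)); [exact: nearW|exact: cvg_cst].
  have cz2 : c (t.1, h t.1) t.2 @[t --> F] --> c (s, h s) z.
    apply: (cs snd).
      exists (B, Y) => /=; first by split; exact: withinT.
      by move=> [s' z'] [].
    by apply: (cvg_trans cvg_snd); exact: cvg_within.
  have : \forall t \near F,
      `|c (t.1, h t.1) z - c (t.1, h t.1) t.2| <= e.
    move/cvgrPdist_lt : cz1 => /(_ _ e2) cz1; move/cvgrPdist_lt : cz2 => /(_ _ e2) cz2.
    apply: filterS2 cz1 cz2 => t; rewrite !ltr_norml !ler_norml.
    by move=> /andP[? ?] /andP[? ?]; apply/andP; split; lra.
  move=> [[U V] /= [sU zV] UV]; exists ([set s' | B s' -> U s'], V) => //=.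
  move=> -[s' z'] [/= Us' Vz'] Bs'.
  by apply: (UV (s', z')); split => //=; exact: Us'.
rewrite near_withinE => zz'; rewrite near_withinE.
apply: filterS zz' => z' zz' Yz'; have {}zz' := zz' Yz'.
rewrite ler_distlC; apply/andP; split.
  apply: graph_cost_ge => // s Bs; rewrite lerBlDr.
  apply: le_trans (graph_cost_le Bs Yz) _.
  by have := zz' s Bs; rewrite /= ler_norml => /andP[]; lra.
rewrite -lerBlDr; apply: graph_cost_ge => // s Bs; rewrite lerBlDr.
apply: le_trans (graph_cost_le Bs Yz') _.
by have := zz' s Bs; rewrite /= ler_norml => /andP[]; lra.
Qed.

Let level_height_le s z : B s -> Y z -> level_height c s z (graph_cost z) <= h s.
Proof.
move=> Bs Yz; have h0 : 0 <= h s by have [] := colh Bs.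
rewrite /level_height; case: ifPn => // _; case: xgetP => // p _ [p0 pz].
rewrite leNgt; apply/negP => hp; have := graph_cost_le Bs Yz; rewrite -pz.
by rewrite leNgt (cost_lt c_increasing).
Qed.

Let level_height_ge0 s z : 0 <= level_height c s z (graph_cost z).
Proof. by rewrite /level_height; case: ifPn => // _; case: xgetP => // p _ []. Qed.

Let level_height_eq s : B s -> 0 < h s ->
  exists j, level_height c s (y j) (graph_cost (y j)) = h s.
Proof.
move=> Bs hs.
have [j cj] : exists j, c (s, h s) (y j) <= sg j.
  apply: contrapT => hN; suff : h s < h s by rewrite ltxx.
  apply/(height_ltP c_lipschitz c_increasing yY _ Bs hs) => j.
  by rewrite ltNge; apply/negP => hj; apply: hN; exists j.
have gj : graph_cost (y j) = c (s, h s) (y j).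
  apply/eqP; rewrite eq_le graph_cost_le//=.
  apply: le_trans cj _; apply: graph_cost_ge; first by exists s.
  move=> s' Bs'; have h0 : 0 <= h s' by have [] := colh Bs'.
  exact: (height_leP c_lipschitz c_increasing yY sg Bs' h0).1.
exists j; rewrite /level_height gj (cost_le c_increasing)// 1?ltW//.
case: xgetP => [p _ [p0 ph]|/(_ (h s)) []]; last by split => //; exact: ltW.
have [hp|ph'|//] := ltgtP (h s) p.
  by have := cost_lt c_increasing Bs (yY j) (ltW hs) hp; rewrite ph ltxx.
by have := cost_lt c_increasing Bs (yY j) p0 ph'; rewrite ph ltxx.
Qed.

Lemma sup_level_height s : B s ->
  sup [set level_height c s z (graph_cost z + 0) | z in Y] = h s.
Proof.
move=> Bs; apply/eqP; rewrite eq_le; apply/andP; split.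
  apply: ge_sup; first by case: Y_neq0 => z Yz; exists (level_height c s z (graph_cost z + 0)), z.
  by move=> _ [z Yz <-]; rewrite addr0; exact: level_height_le.
have ub : has_ubound [set level_height c s z (graph_cost z + 0) | z in Y].
  by exists (h s) => _ [z Yz <-]; rewrite addr0; exact: level_height_le.
have /orP[/eqP <-|h0] : (0 == h s) || (0 < h s).
    by rewrite -le_eqVlt; have [] := colh Bs.
  case: Y_neq0 => z Yz; apply: le_trans (level_height_ge0 s z) _.
  by apply: ub_le_sup => //; exists z; rewrite ?addr0.
have [j <-] := level_height_eq Bs h0.
by apply: ub_le_sup => //; exists (y j); rewrite ?addr0.
Qed.

Lemma height_density_family : B !=set0 -> ac_density B h ->
  exists2 f, density_family B Y c f & forall s, B s -> f s = h s.
Proof.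
move=> B0 [mh h0 hint].
exists (fun s => sup [set level_height c s z (graph_cost z + 0) | z in Y]); last first.
  exact: sup_level_height.
exists graph_cost; first exact: graph_cost_continuous.
exists 0; split => //; split.
- by apply: eq_measurable_fun mh => s /set_mem Bs; rewrite sup_level_height.
- by move=> s Bs; rewrite sup_level_height//; exact: h0.
- by rewrite -hint; apply: eq_integral => s /set_mem Bs; rewrite sup_level_height.
Qed.

End density_family.

(** * Volumes under graphs *)

Section subgraphs.
Context (R : realType) (d : nat).
Local Notation E := (Rspace R d).
Local Notation Leb := (@lebesgue_space R d).
Variable B : set 'rV[R]_d.-1.
Hypothesis mB : measurable B.
Implicit Types f : 'rV[R]_d.-1 -> R.

Let measurable_on_base f : measurable_fun B f ->
  measurable_fun (B `*` [set: R]) (fun x : E => f x.1).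
Proof.
move=> mf; apply: (@measurable_comp _ _ _ _ _ _ B) => //.
  by move=> _ [[s p] [Bs _] <-].
by apply: measurable_funTS; exact: measurable_fst.
Qed.

Let measurable_height D : measurable D -> measurable_fun D (fun x : E => x.2).
Proof. by move=> mD; apply: measurable_funTS; exact: measurable_snd. Qed.

Lemma measurable_subgraph f : measurable_fun B f -> measurable (subgraph B f).
Proof.
move=> mf; have mBT : measurable (B `*` [set: R]) by exact: measurableX.
rewrite (_ : subgraph B f =
    ((B `*` setT) `&` [set x | 0 <= x.2]) `&` ((B `*` setT) `&` [set x | x.2 <= f x.1])).
  apply: measurableI; first by apply: measurable_fun_le => //; exact: measurable_height.
  by apply: measurable_fun_le => //; [exact: measurable_height|exact: measurable_on_base].
apply/seteqP; split => [x [Bx /andP[x0 xf]]|x [[[Bx _] x0] [_ xf]]] //.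
by split => //; apply/andP.
Qed.

Lemma measurable_graph f : measurable_fun B f ->
  measurable [set x : E | B x.1 /\ x.2 = f x.1].
Proof.
move=> mf; have mBT : measurable (B `*` [set: R]) by exact: measurableX.
rewrite (_ : mkset _ =
    ((B `*` setT) `&` [set x : E | f x.1 <= x.2]) `&`
    ((B `*` setT) `&` [set x : E | x.2 <= f x.1])).
  by apply: measurableI; apply: measurable_fun_le => //;
    (exact: measurable_height || exact: measurable_on_base).
apply/seteqP; split => [x [Bx xf]|x [[[Bx _] x0] [_ xf]]] /=.
  by rewrite xf lexx.
by split => //; apply/eqP; rewrite eq_le x0 xf.
Qed.

(** The vertical sections are singletons. *)
Lemma lebesgue_graph f : measurable_fun B f ->
  Leb [set x : E | B x.1 /\ x.2 = f x.1] = 0%E.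
Proof.
move=> mf; apply: lebesgue_space_null_sections2; first exact: measurable_graph.
move=> s; apply: sub_countable (@countable1 R (f s)); apply: subset_card_le.
by move=> p [].
Qed.

Lemma lebesgue_subgraph f : measurable_fun B f -> (forall s, B s -> 0 <= f s) ->
  Leb (subgraph B f) = (\int[lebesgue_rV d.-1]_(s in B) (f s)%:E)%E.
Proof.
move=> mf f0; rewrite /lebesgue_space /product_measure1 [RHS]integral_mkcond.
apply: eq_integral => s _ /=; rewrite patchE; case: ifPn => [/set_mem Bs|/negP nBs].
  rewrite (_ : xsection _ _ = `[0, f s]%classic).
    have := lebesgue_measure_itv `[0, f s]; rewrite /= lte_fin => e.
    rewrite [LHS]e; case: ltP => [_|fs]; first by rewrite sube0.
    by congr EFin; apply/eqP; rewrite eq_le fs f0.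
  apply/seteqP; split => p /=; rewrite /xsection /= inE /subgraph /= in_itv/=.
    by case.
  by [].
rewrite (_ : xsection _ _ = set0) ?measure0//; apply/seteqP; split => p //=.
by rewrite /xsection /= inE => -[/= Bs _]; apply: nBs; rewrite inE.
Qed.

End subgraphs.

Lemma lebesgue_rV_compact_lty (R : realType) n (B : set 'rV[R]_n) : compact B ->
  (lebesgue_rV n B < +oo)%E.
Proof.
move=> B_compact; have mB := closed_measurable_rV (compact_closed_rV B_compact).
have /compact_bounded[M [_ MB]] := B_compact.
pose a := `|M| + 1; have a0 : 0 <= a by rewrite addr_ge0.
pose box := [set v : 'rV[R]_n | forall i,
  (const_mx (- a) : 'rV[R]_n) 0 i <= v 0 i <= (const_mx a : 'rV[R]_n) 0 i].
have vol : (lebesgue_rV n box < +oo)%E.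
  by rewrite lebesgue_rV_box ?ltry// => i; rewrite !mxE; lra.
apply: le_lt_trans vol; apply: le_measure; rewrite ?inE//.
  rewrite (_ : box = \big[setI/setT]_(i < n) ((fun v : 'rV[R]_n => v 0 i) @^-1` `[(- a), a])).
    apply: bigsetI_measurable => i _; rewrite -[X in measurable X]setTI.
    by apply: measurable_coord => //; exact: measurable_itv.
  rewrite -bigcap_seq; apply/seteqP; split => v /= h i.
    by move=> _ /=; rewrite in_itv/=; have := h i; rewrite !mxE.
  by have := h i; rewrite /= in_itv/= !mxE; apply; rewrite mem_index_enum.
move=> v Bv i; rewrite !mxE -ler_norml.
have : `|v| <= a by apply: MB => //; rewrite /a (le_lt_trans (ler_norm M))// ltrDl.
apply: le_trans; rewrite /Num.norm/= mx_normrE.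
exact: (le_bigmax 0 (fun ij : 'I_1 * 'I_n => `|v ij.1 ij.2|) (0, i)).
Qed.

Lemma lebesgue_truncated_column (R : realType) d (B : set 'rV[R]_d.-1) (P : R) :
  compact B -> 0 <= P ->
  lebesgue_space (truncated_column B P) = (P%:E * lebesgue_rV d.-1 B)%E.
Proof.
move=> B_compact P0; have mB := closed_measurable_rV (compact_closed_rV B_compact).
rewrite -(integral_cst _ mB) -lebesgue_subgraph//.
Qed.

(** * The height is a density below the bound P *)

Section density_height.
Context (R : realType) (d : nat).
Local Notation E := (Rspace R d).
Local Notation lam := (lebesgue_rV d.-1).
Variables (B : set 'rV[R]_d.-1) (Y : set E) (c : E -> E -> R).
Hypotheses (B_compact : compact B) (Y_neq0 : Y !=set0).
Hypothesis c_ge0 : nonneg_cost B Y c.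
Hypothesis c_lipschitz : cost_lipschitz B Y c.
Hypothesis c_increasing : cost_increasing B Y c.
Variables (n : nat) (y : 'I_n -> E).
Hypothesis yY : forall j, Y (y j).
Implicit Types sg : 'I_n -> R.

Let mB : measurable B.
Proof. exact: closed_measurable_rV (compact_closed_rV B_compact). Qed.

Lemma measurable_height sg : measurable_fun B (height c y sg).
Proof.
apply: within_measurable_rV => //.
exact: (height_within_continuous c_lipschitz c_increasing yY).
Qed.

Lemma integrable_height sg : lam.-integrable B (EFin \o height c y sg).
Proof.
apply: measurable_bounded_integrable => //.
- exact: lebesgue_rV_compact_lty.
- exact: measurable_height.
- have /continuous_compact/(_ B_compact)/compact_bounded[M [Mr MB]] :=
    height_within_continuous c_lipschitz c_increasing yY (sg := sg).
  by exists M; split => // K MK s Bs; apply: MB => //; exists s.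
Qed.

(** Lowering all the levels by t lowers the mass continuously, down to 0. *)
Lemma height_mass_ivt sg :
  (1 <= \int[lam]_(s in B) (height c y sg s)%:E)%E -> exists2 t, 0 <= t &
  (\int[lam]_(s in B) (height c y (fun j => sg j - t) s)%:E = 1)%E.
Proof.
move=> mass; pose T := \sum_j `|sg j|.
have T0 : 0 <= T by apply: sumr_ge0.
pose f t s := height c y (fun j => sg j - t) s.
have fE sg' : (\int[lam]_(s in B) (height c y sg' s)%:E)%E =
    (\int[lam]_(s in B) (height c y sg' s))%R%:E.
  by rewrite /Rintegral fineK//; exact: integrable_fin_num (integrable_height sg').
have cont : {in `]-1, (T + 1)[%classic, continuous (fun t => \int[lam]_(s in B) f t s)%R}.
  apply: (@continuity_under_integral _ _ _ lam f B mB (-1) (T + 1) _ _ (f (-1))).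
  - by move=> t _; exact: integrable_height.
  - apply: aeW => s Bs t _.
    apply: (height_cvg c_lipschitz c_increasing yY _ Bs).
    + exact: nearW.
    + exact: cvg_cst.
    + by move=> j; apply: cvgB; [exact: cvg_cst|exact: cvg_id].
  - exact: integrable_height.
  - move=> t; rewrite /= in_itv/= => /andP[t1 _]; apply: aeW => s Bs.
    rewrite ger0_norm; last exact: (height_ge0 c_increasing yY).
    by apply: (height_le_homo c_lipschitz c_increasing yY) => // j; lra.
have cont' : {within `[0, T], continuous (fun t => \int[lam]_(s in B) f t s)%R}.
  apply: continuous_in_subspaceT => t /set_mem /=; rewrite in_itv/= => /andP[t0 tT].
  by apply: cont; rewrite inE/= in_itv/=; apply/andP; split; lra.
have f0 : 1 <= (\int[lam]_(s in B) f 0 s)%R.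
  rewrite -lee_fin -fE; apply: le_trans mass _.
  by under [leRHS]eq_integral do under eq_fun do rewrite subr0.
have fT : (\int[lam]_(s in B) f T s)%R = 0.
  rewrite /Rintegral integral0_eq// => s Bs.
  congr EFin; apply: (height_eq0 c_lipschitz c_increasing yY Bs) => j.
  apply: (@le_trans _ _ 0); last by apply: c_ge0 => //; split => //=.
  rewrite subr_le0 (le_trans (ler_norm _))// /T (bigD1 j)//= lerDl.
  by apply: sumr_ge0.
have [|t] := @IVT _ _ 0 T 1 T0 cont'.
  by rewrite ge_min fT ler01 orbT le_max f0.
rewrite in_itv/= => /andP[t0 _] ft; exists t => //.
by rewrite fE -[X in X%:E]/(\int[lam]_(s in B) f t s)%R ft.
Qed.

(** Only the part of the height below P is constrained to have mass 1. Lower the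
    levels until the whole height has mass 1; the result is below P by the bound
    on the family of densities, and has the same mass as the truncated height,
    which dominates it. *)
Lemma truncated_height_density sg (P : R) : 0 <= P ->
  (forall f s, density_family B Y c f -> B s -> f s < P) ->
  (\int[lam]_(s in B) (Num.min (height c y sg s) P)%:E = 1)%E ->
  ac_density B (height c y sg) /\ forall s, B s -> height c y sg s < P.
Proof.
move=> P0 P_bound mass1.
have B0 : B !=set0.
  apply/set0P/eqP => B0; move: mass1; rewrite B0 integral_set0 => /eqP.
  by rewrite eqe eq_sym oner_eq0.
have h_ge0 sg' s : B s -> 0 <= height c y sg' s := @height_ge0 _ _ _ _ _ c_increasing _ _ yY sg' s.
have lt_P sg' : ac_density B (height c y sg') -> forall s, B s -> height c y sg' s < P.
  move=> /(height_density_family B_compact Y_neq0 c_ge0 c_lipschitz c_increasing yY B0)[f Sf fh].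
  by move=> s Bs; rewrite -fh//; exact: P_bound.
have densityP sg' : (\int[lam]_(s in B) (height c y sg' s)%:E = 1)%E ->
    ac_density B (height c y sg').
  by move=> hm; split => //; [exact: measurable_height|exact: h_ge0].
suff h1 : (\int[lam]_(s in B) (height c y sg s)%:E = 1)%E.
  by have := densityP _ h1; split => //; exact: lt_P.
have mass : (1 <= \int[lam]_(s in B) (height c y sg s)%:E)%E.
  rewrite -mass1; apply: ge0_le_integral => //.
  - move=> s Bs; rewrite lee_fin le_min h_ge0//.
  - apply/measurable_EFinP; apply: measurable_minr => //; exact: measurable_height.
  - apply/measurable_EFinP; exact: measurable_height.
  - by move=> s Bs; rewrite lee_fin ge_min lexx.
have [t t0 ht1] := height_mass_ivt mass.
pose ht := height c y (fun j => sg j - t); pose h := height c y sg.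
have htP := lt_P _ (densityP _ ht1).
have ht_h s : B s -> ht s <= h s.
  by move=> Bs; apply: (height_le_homo c_lipschitz c_increasing yY) => // j; lra.
have imin : lam.-integrable B (fun s => (Num.min (h s) P)%:E).
  apply: (le_integrable mB _ _ (integrable_height sg)).
    by apply/measurable_EFinP; apply: measurable_minr => //; exact: measurable_height.
  move=> s Bs; rewrite !abse_EFin lee_fin !ger0_norm ?ge_min ?lexx ?h_ge0//.
  by rewrite le_min h_ge0.
have int0 : (\int[lam]_(s in B) `|(Num.min (h s) P - ht s)%:E| = 0)%E.
  transitivity (\int[lam]_(s in B) ((Num.min (h s) P)%:E - (ht s)%:E))%E.
    apply: eq_integral => s /set_mem Bs; rewrite gee0_abs// lee_fin subr_ge0.
    by rewrite le_min ht_h//= ltW// htP.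
  rewrite integralB_EFin//; last exact: integrable_height.
  by rewrite mass1 [X in (1 - X)%E]ht1 subee.
have /ae_eq_integral_abs : measurable_fun B (fun s => (Num.min (h s) P - ht s)%:E).
  apply/measurable_EFinP; apply: measurable_funB; last exact: measurable_height.
  by apply: measurable_minr => //; exact: measurable_height.
move=> /(_ lam mB) [+ _] => /(_ int0) ae0.
rewrite -[RHS]ht1; apply: ae_eq_integral => //.
- by apply/measurable_EFinP; exact: measurable_height.
- by apply/measurable_EFinP; exact: measurable_height.
apply: filterS ae0 => s /[swap] Bs /(_ Bs) [] /eqP; rewrite subr_eq0 => /eqP hht.
congr EFin; have := htP s Bs; rewrite -/(ht s) -hht -/(h s).
by rewrite minElt; case: ifP => // _; rewrite ltxx.
Qed.

End density_height.

(** * The twist condition makes ties negligible *)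

Section twist.
Context (R : realType) (d : nat).
Local Notation E := (Rspace R d).
Local Notation Leb := (@lebesgue_space R d).
Variables (B : set 'rV[R]_d.-1) (Y : set E) (c : E -> E -> R).
Hypothesis c_lipschitz : cost_lipschitz B Y c.
Hypothesis c_twist : extended_twist B Y c.

Let partial_quotient (f : E -> E -> R) (e x y : E) :
  (fun t : R => t^-1 *: ((f^~ y \o shift x) (t *: e) - f x y)) =
  (fun t : R => t^-1 *: (((fun z : E * E => f z.1 z.2) \o shift (x, y)) (t *: (e, 0))
    - f x y)).
Proof. by apply/funext => t /=; rewrite [X in f _ (X + _)]scaler0 add0r. Qed.

Lemma derive_partial (f : E -> E -> R) (e x y : E) :
  'D_e (f^~ y) x = 'D_(e, 0) (fun z : E * E => f z.1 z.2) (x, y).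
Proof. by rewrite /derive partial_quotient. Qed.

Lemma derivable_partial (f : E -> E -> R) (e x y : E) :
  derivable (fun z : E * E => f z.1 z.2) (x, y) (e, 0) -> derivable (f^~ y) x e.
Proof. by rewrite /derivable partial_quotient. Qed.

(** A point of the level set with a non-zero directional derivative is isolated on
    its line. *)
Lemma level_set_isolated (g : E -> R) (e x : E) (k : R) :
  countable [set t : R | [/\ g (x + t *: e) = k,
    derivable g (x + t *: e) e & 'D_e g (x + t *: e) != 0]].
Proof.
set S := mkset _; apply: (@sub_countable _ _ S _ _ (@countable_isolated R S)).
apply: subset_card_le => t St; have [gt dg Dg] := St.
have : \forall h \near 0^', h^-1 *: (g (h *: e + (x + t *: e)) - g (x + t *: e)) != 0.
  have dg' : h^-1 *: (g (h *: e + (x + t *: e)) - g (x + t *: e)) @[h --> 0^'] -->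
    'D_e g (x + t *: e) := dg.
  exact: (cvgr_neq0 _ dg' Dg).
rewrite near_withinE => /nbhs_normP[r /= r0 tr]; split; first by rewrite inE.
exists (ball t r); first exact: nbhsx_ballx.
apply/seteqP; split => [u [ut [gu _ _]]|_ ->]; last by split => //; exact: ballxx.
apply/eqP/negPn/negP => ntu; have := tr (u - t).
rewrite /= sub0r normrN distrC => /(_ ut); rewrite subr_eq0 => /(_ ntu) /negP; apply.
by rewrite addrCA -scalerDl subrK gu gt subrr scaler0.
Qed.

Let tie (D : set E) (y1 y2 : E) (k : R) := [set x | D x /\ c x y1 - c x y2 = k].

Lemma measurable_tie (D : set E) y1 y2 k : measurable D -> D `<=` column B ->
  Y y1 -> Y y2 -> measurable (tie D y1 y2 k).
Proof.
move=> mD DB Yy1 Yy2.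
have mc : measurable_fun D (fun x => c x y1 - c x y2).
  by apply: measurable_funB; apply: within_measurable_space => //;
    exact: (cost_within1 c_lipschitz).
have := mc mD [set k] (measurable_set1 k).
by congr measurable; apply/seteqP; split => x [].
Qed.

(** The gradients in x at two distinct targets differ in some coordinate, and the
    ties with a difference in a given coordinate have countable sections along
    that coordinate. *)
Lemma tie_null (D : set E) y1 y2 k : measurable D -> D `<=` column B ->
  Y y1 -> Y y2 -> y1 <> y2 -> Leb (tie D y1 y2 k) = 0%E.
Proof.
move=> mD DB Yy1 Yy2 y12.
have mN := measurable_tie k mD DB Yy1 Yy2.
have [OX [OY [f [[oX oY BX YOY] [fc [[df cDf] [f_inj _]]]]]]] := c_twist.
pose g x := f x y1 - f x y2.
have derf e x z : D x -> Y z -> derivable (f^~ z) x e.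
  move=> Dx Yz; apply: derivable_partial; apply: diff_derivable.
  by apply: df; split; [exact/BX/DB|exact: YOY].
pose F (z : E * E) := f z.1 z.2.
have contf e x z : D x -> Y z -> 'D_e (f^~ z) x' @[x' --> x] --> 'D_e (f^~ z) x.
  move=> Dx Yz; have cD := cDf (e, 0) (x, z) (conj (BX _ (DB _ Dx)) (YOY _ Yz)).
  have -> : (fun x' => 'D_e (f^~ z) x') = (fun x' => 'D_(e, 0) F (x', z)).
    by apply/funext => x'; exact: derive_partial.
  rewrite derive_partial.
  have xz : (x', z) @[x' --> x] --> (x, z).
    have h1 : (x' : E) @[x' --> x] --> x by exact: cvg_id.
    have h2 : (z : E) @[x' --> x] --> z by exact: cvg_cst.
    exact: (cvg_pair h1 h2).
  exact: (cvg_comp _ _ xz cD).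
pose N e := tie D y1 y2 k `&` [set x | 'D_e (f^~ y1) x != 'D_e (f^~ y2) x].
have mNe e : measurable (N e).
  apply: measurable_near_space => // x [Dx _] /= De.
  have cg : (fun x' => 'D_e (f^~ y1) x' - 'D_e (f^~ y2) x') @ x -->
      'D_e (f^~ y1) x - 'D_e (f^~ y2) x.
    by apply: cvgB; exact: contf.
  have : 'D_e (f^~ y1) x - 'D_e (f^~ y2) x != 0 by rewrite subr_eq0.
  by move=> /(cvgr_neq0 _ cg); apply: filterS => x'; rewrite subr_eq0.
have sec e x : countable [set t : R | N e (x + t *: e)].
  apply: sub_countable (level_set_isolated g e x k); apply: subset_card_le.
  move=> t [[Dx ck] /= De].
  have d1 := derf e _ _ Dx Yy1; have d2 := derf e _ _ Dx Yy2.
  split.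
  - by rewrite /g !fc//; exact: DB.
  - exact: (derivableB d1 d2).
  - by rewrite (deriveB d1 d2) subr_eq0.
pose Nlast := N (0, 1); pose Nfirst (i : 'I_d.-1) := N (delta_mx 0 i, 0).
have null_first : measurable (\big[setU/set0]_i Nfirst i) /\ Leb (\big[setU/set0]_i Nfirst i) = 0%E.
  apply: (big_ind (fun A => measurable A /\ Leb A = 0%E)).
  - by split => //; exact: measure0.
  - move=> A A' [mA A0] [mA' A'0]; split; first exact: measurableU.
    exact: null_set_setU.
  - move=> i _; split; first exact: mNe.
    by apply: (@lebesgue_space_null_sections1 _ _ _ i); [exact: mNe|exact: sec].
have null_last : Leb Nlast = 0%E.
  apply: lebesgue_space_null_sections2; first exact: mNe.
  move=> s; apply: sub_countable (sec (0, 1) (s, 0)); apply: subset_card_le => p /=.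
  congr (N _ _); congr pair => /=.
    by rewrite [X in _ + X]scaler0 addr0.
  by rewrite add0r [RHS]mulr1.
apply: (@subset_measure0 _ _ _ Leb _ (Nlast `|` \big[setU/set0]_i Nfirst i)) => //.
- by apply: measurableU; [exact: mNe|exact: null_first.1].
- move=> x Nx; have [De|/negPn/eqP De] :=
    boolP ('D_((0, 1) : E) (f^~ y1) x != 'D_((0, 1) : E) (f^~ y2) x).
    by left.
  right; apply: contrapT => Nfx; apply: y12.
  have Yin z : Y z -> z \in OY by move=> Yz; rewrite inE; exact: YOY.
  apply: (f_inj x); [exact: BX (DB _ Nx.1)|exact: Yin|exact: Yin|].
  rewrite /gradient De; congr pair; apply/rowP => i; rewrite !mxE.
  apply/eqP/negPn/negP => Di; apply: Nfx; rewrite (bigD1 i)//=; left.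
  by split.
- by apply: null_set_setU => //; [exact: mNe|exact: null_first.1|exact: null_first.2].
Qed.

End twist.

(** By monotonicity, the vertical sections have at most one point. *)
Lemma level_null (R : realType) d (B : set 'rV[R]_d.-1) (Y : set (Rspace R d))
    (c : Rspace R d -> Rspace R d -> R) (D : set (Rspace R d)) y k :
  cost_lipschitz B Y c -> cost_increasing B Y c ->
  measurable D -> D `<=` column B -> Y y ->
  measurable [set x | D x /\ c x y = k] /\
  lebesgue_space [set x | D x /\ c x y = k] = 0%E.
Proof.
move=> c_lipschitz c_increasing mD DB Yy.
have mc : measurable_fun D (c^~ y).
  by apply: within_measurable_space => //; exact: (cost_within1 c_lipschitz).
have mL : measurable [set x | D x /\ c x y = k].
  have := mc mD [set k] (measurable_set1 k).
  by congr measurable; apply/seteqP; split => x [].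
split => //; apply: lebesgue_space_null_sections2 => // s.
have [-> //|/set0P[p [Dp pk]]] := eqVneq [set p | D (s, p) /\ c (s, p) y = k] set0.
apply: sub_countable (@countable1 R p); apply: subset_card_le => q [Dq qk] /=.
have [/= Bs p0] := DB _ Dp; have [_ /= q0] := DB _ Dq.
have [qp|pq|//] := ltgtP q p.
  by have := cost_lt c_increasing Bs Yy q0 qp; rewrite pk qk ltxx.
by have := cost_lt c_increasing Bs Yy p0 pq; rewrite pk qk ltxx.
Qed.

(** * Integrals against couplings with an atomic measure *)

Section null_integral.
Context d (T : measurableType d) (R : realType) (mu : {measure set T -> \bar R}).
Local Open Scope ereal_scope.
Import HBNNSimple.

(** A simple function below the integrand keeps its integral when it is cut to zero
    on N. No measurability of f is involved, because the cost of a transport map is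
    an arbitrary function where the map leaves Y. *)
Lemma integral_setD_null (D N : set T) (f : T -> \bar R) :
  measurable N -> mu N = 0 -> \int[mu]_(x in D) f x = \int[mu]_(x in D `\` N) f x.
Proof.
move=> mN N0; have mCN : measurable (~` N) by exact: measurableC.
suff ge0 g : (forall x, 0 <= g x) ->
    \int[mu]_(x in D) g x = \int[mu]_(x in D `\` N) g x.
  by rewrite integralE [RHS]integralE !ge0// => x; exact: funeneg_ge0 || exact: funepos_ge0.
move=> g0; rewrite !ge0_integralE//; apply/eqP; rewrite eq_le; apply/andP; split.
  apply: ge_ereal_sup => _ [h /= hg <-].
  pose h' := mul_nnsfun h (indic_nnsfun R mCN).
  have -> : sintegral mu h = sintegral mu h'.
    have := integral_nnsfun mu measurableT h.
    have := integral_nnsfun mu measurableT h'.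
    rewrite !patch_setT => <- <-.
    apply: ge0_ae_eq_integral => //.
    - by apply/measurable_EFinP; exact: measurable_funP.
    - by apply/measurable_EFinP; exact: measurable_funP.
    - by move=> x _; rewrite lee_fin.
    - by move=> x _; rewrite lee_fin.
    - exists N; split => // x /= hx; apply: contrapT => Nx; apply: hx => _.
      by rewrite /= mindicE mem_set// mulr1.
  apply: ereal_sup_ubound; exists h' => // x /=.
  rewrite /= mindicE; case: (boolP (x \in ~` N)) => xN.
    by have := hg x; rewrite mulr1 !patchE in_setD; move: xN; rewrite in_setC => ->; rewrite andbT.
  by rewrite mulr0 patchE; case: ifPn.
apply: le_ereal_sup => _ [h /= hg <-]; exists h => //= x.
apply: le_trans (hg x) _; rewrite !patchE in_setD; case: (x \in D) => //=.
by case: ifPn.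
Qed.

End null_integral.

Section finite_sets.
Context (R : realType) (d n : nat).
Local Notation E := (Rspace R d).
Variable y : 'I_n -> E.

Lemma range_ord_compact : compact (range y).
Proof. exact/finite_compact/finite_image. Qed.

Lemma measurable_space1 (z : E) : measurable [set z].
Proof. by apply: closed_measurable_space; apply: compact_closed_space; exact: compact_set1. Qed.

Lemma range_ord_measurable : measurable (range y).
Proof.
by apply: closed_measurable_space; apply: compact_closed_space; exact: range_ord_compact.
Qed.

Lemma atomic_set1 (m : 'I_n -> R) i : injective y -> atomic y m [set y i] = (m i)%:E.
Proof.
move=> y_inj; rewrite /atomic (bigD1 i)//= diracE mem_set// mule1 big1 ?adde0// => j ji.
rewrite diracE memNset ?mule0// => /y_inj jE.
by move: ji; rewrite jE eqxx.
Qed.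

Lemma atomic_rangeC (m : 'I_n -> R) : atomic y m (~` range y) = 0%E.
Proof.
rewrite /atomic big1// => i _; rewrite diracE memNset ?mule0// => /= h.
by apply: h; exists i.
Qed.

Lemma atomic_setT (m : 'I_n -> R) : atomic y m setT = (\sum_i m i)%:E.
Proof.
rewrite /atomic -sumEFin; apply: eq_bigr => i _.
by rewrite diracE mem_set// mule1.
Qed.

End finite_sets.

Section coupling_integral.
Context (R : realType) (d n : nat).
Local Notation E := (Rspace R d).
Local Notation Leb := (@lebesgue_space R d).
Variables (y : 'I_n -> E) (m : 'I_n -> R).
Hypotheses (y_inj : injective y) (m_sum : \sum_i m i = 1).
Variables (X : set E) (g : {measure set (E * E)%type -> \bar R}).
Hypotheses (mX : measurable X) (g_coupling : coupling X (atomic y m) g).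

Let W := X `*` range y.

Let mW : measurable W.
Proof. by apply: measurableX => //; exact: range_ord_measurable. Qed.

Lemma coupling_null : g (~` W) = 0%E.
Proof.
have mR := range_ord_measurable y.
have -> : ~` W = (~` X `*` setT) `|` (setT `*` ~` range y).
  apply/seteqP; split => [[x z] /= h|[x z] [[/= nX _] [/= Xx _]//|[/= _ nz] [/= _ rz]//]].
  by have [Xx|nX] := pselect (X x); [right; split => // rz; exact: h|left].
apply: null_set_setU.
- by apply: measurableX => //; exact: measurableC.
- by apply: measurableX => //; exact: measurableC.
- by have [-> _] := g_coupling (measurableC mX); rewrite setICl measure0.
- by have [_ ->] := g_coupling (measurableC mR); exact: atomic_rangeC.
Qed.

(** A coupling is concentrated on X times the atoms, so every integral against it
    only sees this set. *)
Lemma coupling_supp (A : set (E * E)) (f : E * E -> \bar R) :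
  (\int[g]_(w in A) f w = \int[g]_(w in A `&` W) f w)%E.
Proof.
rewrite (integral_setD_null _ _ (measurableC mW) coupling_null).
by rewrite setDE setCK.
Qed.

Lemma coupling_mass (A : set (E * E)) : measurable A -> W `<=` A -> g A = 1%E.
Proof.
move=> mA WA; have gT : g setT = 1%E.
  by rewrite -setXTT; have [_ ->] := g_coupling measurableT; rewrite atomic_setT m_sum.
rewrite -gT [RHS](measureDI g measurableT mA) setTI setTD.
rewrite [X in (X + _)%E](_ : _ = 0%E) ?add0e//.
apply: subset_measure0 coupling_null; [exact: measurableC|exact: measurableC|].
exact: subsetC.
Qed.

Lemma coupling_integral1 (b : E -> \bar R) : measurable_fun X b ->
  (forall x, X x -> (0 <= b x)%E) ->
  (\int[g]_(w in W) b w.1 = \int[Leb]_(x in X) b x)%E.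
Proof.
move=> mb b0; have -> : W = (X `*` setT) `&` W.
  by apply/seteqP; split => [[x z] [Xx rz]|? []].
rewrite -coupling_supp -(_ : fst @^-1` X = X `*` setT); last first.
  by apply/seteqP; split => [[x z] //|[x z] []].
rewrite -(@ge0_integral_pushforward _ _ _ _ _ fst measurable_fst g X b)//; last first.
  by move=> x /set_mem; exact: b0.
apply: eq_measure_integral => A mA AX; rewrite /= /pushforward.
rewrite (_ : fst @^-1` A = A `*` setT).
  by have [-> _] := g_coupling mA; rewrite setIidl.
by apply/seteqP; split => [[x z] //|[x z] []].
Qed.

Let atom_sum (a : E -> R) : {in W, forall w, \sum_i a (y i) * \1_(setT `*` [set y i]) w =
  a w.2}.
Proof.
move=> [x z] /set_mem [/= Xx [i _ <-]].
rewrite (bigD1 i)//= indicE mem_set// mulr1 big1 ?addr0// => j ji.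
rewrite indicE memNset ?mulr0//= => -[_ /y_inj ij].
by move: ji; rewrite ij eqxx.
Qed.

Let measurable_atom i : measurable (setT `*` [set y i] : set (E * E)).
Proof. by apply: measurableX => //; exact: measurable_space1. Qed.

Let measurable_snd_W (a : E -> R) : measurable_fun W (fun w => a w.2).
Proof.
apply: eq_measurable_fun (@atom_sum a) _; apply: measurable_sum => i.
by apply: measurable_funM => //; exact: measurable_indic.
Qed.

Lemma coupling_integral2 (a : E -> R) : (forall i, 0 <= a (y i)) ->
  (\int[g]_(w in W) (a w.2)%:E = \sum_i (m i * a (y i))%:E)%E.
Proof.
move=> a0; have mi := measurable_atom.
transitivity (\int[g]_(w in W) (\sum_i (a (y i))%:E * (\1_(setT `*` [set y i]) w)%:E))%E.
  by apply: eq_integral => w Ww; rewrite -(atom_sum a Ww) -sumEFin.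
rewrite ge0_integral_sum//; last 2 first.
- move=> i; apply: emeasurable_funM; first exact: measurable_cst.
  by apply/measurable_EFinP; exact: measurable_indic.
- by move=> i w _; rewrite -EFinM lee_fin mulr_ge0.
apply: eq_bigr => i _; rewrite ge0_integralZl//; last 2 first.
- by apply/measurable_EFinP; exact: measurable_indic.
- by rewrite lee_fin.
rewrite integral_indic// EFinM muleC; congr (_ * _)%E.
have [_] := g_coupling (measurable_space1 (y i)).
rewrite atomic_set1// => <-; rewrite [RHS](measureDI g (mi i) mW).
rewrite [X in (_ = X + _)%E](_ : _ = 0%E) ?add0e//.
apply: subset_measure0 coupling_null.
- exact: measurableD.
- exact: measurableC.
- by move=> w [].
Qed.

(** The duality inequality of optimal transport, kept as an identity: the last
    integral is the gap. The constant K makes all the integrands nonnegative, so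
    that no integral has to be finite. *)
Lemma coupling_integral (A : set (E * E)) (f : E * E -> R) (K : R)
    (a b : E -> R) (s := fun w => f w + K - a w.2 - b w.1) :
  measurable A -> W `<=` A -> measurable_fun A f -> 0 <= K ->
  measurable_fun X b -> (forall w, A w -> 0 <= f w) ->
  (forall i, 0 <= a (y i)) -> (forall x, X x -> 0 <= b x) ->
  (forall w, W w -> 0 <= s w) ->
  (\int[g]_(w in A) (f w)%:E + K%:E = (\sum_i m i * a (y i))%:E +
    \int[Leb]_(x in X) (b x)%:E + \int[g]_(w in W) (s w)%:E)%E.
Proof.
move=> mA WA mf K0 mb f0 a0 b0 s0.
have fabs w : f w + K = a w.2 + b w.1 + s w by rewrite /s; lra.
have -> : (\int[g]_(w in A) (f w)%:E + K%:E = \int[g]_(w in A) ((f w)%:E + K%:E))%E.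
  rewrite ge0_integralD//; last first.
  - exact/measurable_EFinP.
  by rewrite [X in (_ = _ + X)%E]integral_cst// coupling_mass// mule1.
rewrite coupling_supp (setIidr WA).
have mfst (h : E -> R) : measurable_fun X h -> measurable_fun W (fun w => h w.1).
  move=> mh; apply: (@measurable_comp _ _ _ _ _ _ X) => //; first by move=> _ [w [] /= ? _ <-].
  by apply: measurable_funTS; exact: measurable_fst.
have ms : measurable_fun W s.
  apply: measurable_funB; last exact: mfst.
  apply: measurable_funB; last exact: measurable_snd_W.
  by apply: measurable_funD => //; exact: measurable_funS mf.
have a0W w : W w -> 0 <= a w.2 by case: w => x z [/= _ [i _ <-]].
transitivity (\int[g]_(w in W) (((a w.2)%:E + (b w.1)%:E) + (s w)%:E))%E.
  by apply: eq_integral => w /set_mem Ww; rewrite -!EFinD fabs.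
rewrite ge0_integralD//; last 3 first.
- by move=> w Ww; rewrite -EFinD lee_fin addr_ge0 ?a0W// b0//; case: Ww.
- by apply/measurable_EFinP; apply: measurable_funD; [exact: measurable_snd_W|exact: mfst].
- exact/measurable_EFinP.
rewrite ge0_integralD//; last 3 first.
- by apply/measurable_EFinP; exact: measurable_snd_W.
- by move=> w Ww; rewrite lee_fin b0//; case: Ww.
- by apply/measurable_EFinP; exact: mfst.
rewrite coupling_integral2// sumEFin (@coupling_integral1 (EFin \o b))//.
exact/measurable_EFinP.
Qed.

End coupling_integral.

Lemma measurable_extend d1 d2 (T1 : measurableType d1) (T2 : measurableType d2)
    (X : set T1) (f : T1 -> T2) (z : T2) : measurable X -> measurable_fun X f ->
  measurable_fun setT (fun x => if x \in X then f x else z).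
Proof.
move=> mX mf; rewrite -(setUv X); apply/measurable_funU => //; first exact: measurableC.
split; first by apply: eq_measurable_fun mf => x ->.
have fz : {in ~` X, cst z =1 (fun x => if x \in X then f x else z)}.
  by move=> x; rewrite in_setC => /negbTE ->.
exact: eq_measurable_fun fz (measurable_cst _).
Qed.

Lemma measurable_graph_map d1 d2 (T1 : measurableType d1) (T2 : measurableType d2)
    (X : set T1) (f : T1 -> T2) : measurable X -> measurable_fun X f ->
  measurable_fun X (fun x => (x, f x)).
Proof.
move=> mX mf; have [->|/set0P[x0 _]] := eqVneq X set0.
  by move=> _ A _; rewrite set0I.
have mG : measurable_fun setT (fun x => (x, if x \in X then f x else f x0)).
  by apply: measurable_fun_pair; [exact: measurable_id|exact: measurable_extend].
by apply: eq_measurable_fun (measurable_funTS mG) => x /= ->.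
Qed.

(** Transport maps induce couplings; away from X the map is replaced by a constant to
    make it measurable, and the targets outside Y only concern a null set. *)
Lemma transport_coupling (R : realType) (d : nat) (X Y : set (Rspace R d))
    (nu : set (Rspace R d) -> \bar R) (T : Rspace R d -> Rspace R d) :
  measurable X -> transport_map X Y nu T ->
  exists2 g : {measure set (Rspace R d * Rspace R d)%type -> \bar R}, coupling X nu g &
    forall (A : set (Rspace R d * Rspace R d)) (f : Rspace R d * Rspace R d -> \bar R),
      measurable A -> measurable_fun A f -> (forall w, A w -> (0 <= f w)%E) ->
      (forall x, X x -> Y (T x) -> A (x, T x)) ->
      (\int[g]_(w in A) f w = \int[lebesgue_space]_(x in X) f (x, T x))%E.
Proof.
move=> mX [mT TY Tnu].
pose T0 x := if x \in X then T x else (0 : Rspace R d).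
have mT0 : measurable_fun setT T0 by exact: measurable_extend.
pose G x := (x, T0 x).
have mG : measurable_fun setT G by exact: measurable_fun_pair.
pose mu := mrestr (@lebesgue_space R d) mX.
pose g : {measure set (Rspace R d * Rspace R d)%type -> \bar R} :=
  measure_function_pushforward__canonical__measure_function_Measure mu mG.
exists g.
  move=> A mA; split; rewrite /g /= /pushforward /mu /mrestr.
    have -> : G @^-1` (A `*` setT) = A by apply/seteqP; split => [x []|x Ax].
    by [].
  rewrite -Tnu//; congr (lebesgue_space _); apply/seteqP; split => x /=.
    by move=> [[_ /=]]; rewrite /T0 => /[swap] Xx; rewrite mem_set.
  by move=> [Xx AT]; split => //; split => //=; rewrite /T0 mem_set.
move=> A f mA mf f0 XYA.
have mGA : measurable (G @^-1` A) by rewrite -[X in measurable X]setTI; exact: (mG measurableT _ mA).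
have mfG : measurable_fun (G @^-1` A) (f \o G).
  apply: (measurable_comp mA) => //; first by move=> _ [x ? <-].
  exact: measurable_funTS.
transitivity (\int[mu]_(x in G @^-1` A) (f \o G) x)%E.
  by apply: ge0_integral_pushforward => // w /set_mem; exact: f0.
have muX : mu (~` X) = 0%E by rewrite /mu /= /mrestr setICl measure0.
rewrite (integral_setD_null _ _ (measurableC mX) muX) setDE setCK.
transitivity (\int[lebesgue_space]_(x in G @^-1` A `&` X) (f \o G) x)%E.
  by apply: eq_measure_integral => S mS SX; rewrite /mu /= /mrestr setIidl// => x /SX [].
have [N [mN N0 TN]] := TY.
rewrite (integral_setD_null _ _ mN N0) [RHS](integral_setD_null _ _ mN N0).
rewrite (_ : (G @^-1` A `&` X) `\` N = X `\` N).
  by apply: eq_integral => x /set_mem [Xx _]; rewrite /= /G /T0 mem_set.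
apply/seteqP; split => x [].
  by move=> [_ Xx] Nx.
move=> Xx Nx; split => //; split => //; rewrite /G /T0 /= mem_set//.
by apply: XYA => //; apply: contrapT => nY; apply: Nx; apply: TN => /(_ Xx).
Qed.

(** * Optimality of the Laguerre partition *)

Section optimality.
Context (R : realType) (d n : nat).
Local Notation E := (Rspace R d).
Local Notation Leb := (@lebesgue_space R d).
Local Notation lam := (lebesgue_rV d.-1).
Variables (B : set 'rV[R]_d.-1) (Y : set E) (c : E -> E -> R).
Hypotheses (B_compact : compact B) (Y_compact : compact Y).
Hypothesis c_ge0 : nonneg_cost B Y c.
Hypothesis c_lipschitz : cost_lipschitz B Y c.
Hypothesis c_increasing : cost_increasing B Y c.
Variables (y : 'I_n -> E) (m : 'I_n -> R) (sigma : E -> R).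
Hypotheses (yY : forall i, Y (y i)) (y_inj : injective y).
Hypothesis m_sum : \sum_i m i = 1.
Hypothesis sigma_cont : {within Y, continuous sigma}.

Let sg i := sigma (y i).
Let h := height c y sg.
Let nu := atomic y m.

(** What the cheapest target costs above its price: negative strictly below the
    graph of the height, nonnegative on and above it. *)
Definition surplus := ctransform c (range y) sigma.

Let col_closed : closed (column B).
Proof.
apply: closedI.
  apply: (@closed_comp _ _ (fun x : E => x.1) B); last exact: compact_closed_rV.
  by move=> x _; exact: cvg_fst.
apply: (@closed_comp _ _ (fun x : E => x.2) [set p | 0 <= p]); last exact: closed_ge.
by move=> x _; exact: cvg_snd.
Qed.

Let mcol : measurable (column B). Proof. exact: closed_measurable_space. Qed.

Let mY : measurable Y.
Proof. by apply: closed_measurable_space; exact: compact_closed_space. Qed.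

Let mB : measurable B.
Proof. exact: closed_measurable_rV (compact_closed_rV B_compact). Qed.

Let rangeY : range y `<=` Y.
Proof. by move=> _ [i _ <-]. Qed.

Let i0 : 'I_n.
Proof.
apply: xchoose (_ : exists i : 'I_n, true); apply: contrapT => nI.
move: m_sum; rewrite big1 => [/esym/eqP|i _]; first by rewrite oner_eq0.
by exfalso; apply: nI; exists i.
Qed.

Let sigma_range : {within range y, continuous sigma}.
Proof. exact: continuous_subspaceW rangeY sigma_cont. Qed.

Let c_range x z : column B x -> range y z -> 0 <= c x z.
Proof. by move=> Bx /rangeY; exact: c_ge0. Qed.

Lemma surplus_le x i : column B x -> surplus x <= c x (y i) - sg i.
Proof.
move=> Bx; have ri : range y (y i) by exists i.
exact: (ctransform_le (@range_ord_compact _ _ _ y) c_range sigma_range Bx ri).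
Qed.

Lemma surplus_ge x a : (forall i, a <= c x (y i) - sg i) -> a <= surplus x.
Proof.
move=> ha; apply: (@ctransform_ge _ _ (range y) c (y i0)); first by exists i0.
by move=> _ [i _ <-]; exact: ha.
Qed.

Lemma measurable_surplus : measurable_fun (column B) surplus.
Proof.
apply: (@measurable_ctransform _ _ _ _ _ (y i0)) => //.
- exact: range_ord_compact.
- by move=> z /rangeY Yz; exact: (cost_within1 c_lipschitz).
Qed.

Let h_ge0 s : B s -> 0 <= h s.
Proof. exact: (height_ge0 c_increasing yY). Qed.

Lemma surplus_lt0 s p : B s -> 0 <= p -> p < h s -> surplus (s, p) < 0.
Proof.
move=> Bs p0 /(height_gtP c_lipschitz c_increasing yY sg Bs p0)[i ci].
by apply: le_lt_trans (surplus_le i _) _ => //; rewrite subr_lt0.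
Qed.

Lemma surplus_ge0 s p : B s -> 0 <= p -> h s <= p -> 0 <= surplus (s, p).
Proof.
move=> Bs p0 /(height_leP c_lipschitz c_increasing yY sg Bs p0) ci.
by apply: surplus_ge => i; rewrite subr_ge0.
Qed.

(* A bound on the prices, added wherever an integrand has to be nonnegative. *)
Let K := \sum_i `|sg i|.

Let K_ge0 : 0 <= K. Proof. by apply: sumr_ge0. Qed.

Let sg_K i : `|sg i| <= K.
Proof. by rewrite /K (bigD1 i)//= lerDl; apply: sumr_ge0. Qed.

Let surplusK_ge0 x : column B x -> 0 <= surplus x + K.
Proof.
move=> Bx; rewrite -lerBlDr sub0r; apply: surplus_ge => i.
have := c_ge0 Bx (yY i); have := le_trans (ler_norm _) (sg_K i); lra.
Qed.

Let gap (w : E * E) := c w.1 w.2 + (K + K) - (sigma w.2 + K) - (surplus w.1 + K).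

Let gapE x i : gap (x, y i) = c x (y i) - sg i - surplus x.
Proof. by rewrite /gap/= -/(sg i); ring. Qed.

Let mcost : measurable_fun (column B `*` Y) (fun w : E * E => c w.1 w.2).
Proof.
apply: within_measurable_space2; first exact: measurableX.
exact: cost_within_continuous.
Qed.

Let V (X : set E) : \bar R := ((\sum_i m i * (sg i + K))%:E +
  \int[Leb]_(x in X) (surplus x + K)%:E)%E.

Let coupling_gap (X : set E) (g : {measure set (E * E)%type -> \bar R}) :
  measurable X -> X `<=` column B -> coupling X nu g ->
  (\int[g]_(w in column B `*` Y) (c w.1 w.2)%:E + (K + K)%:E =
    V X + \int[g]_(w in X `*` range y) (gap w)%:E)%E.
Proof.
move=> mX XB gX.
rewrite (@coupling_integral _ _ _ _ _ y_inj m_sum X g mX gX (column B `*` Y)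
  (fun w => c w.1 w.2) (K + K) (fun z => sigma z + K) (fun x => surplus x + K))//.
- exact: measurableX.
- by move=> [x z] [/= /XB ? /rangeY].
- exact: addr_ge0.
- by apply: measurable_funD => //; exact: measurable_funS measurable_surplus.
- by move=> [x z] [/= Bx Yz]; exact: c_ge0.
- by move=> i; have := sg_K i; rewrite ler_norml => /andP[+ _]; rewrite -/(sg i); lra.
- by move=> x /XB; exact: surplusK_ge0.
- move=> [x z] [/= /XB Bx [i _ <-]]; have := surplus_le i Bx; rewrite -/(sg i); lra.
Qed.

Let gap_ge0 X w : X `<=` column B -> (X `*` range y) w -> 0 <= gap w.
Proof.
move=> XB; case: w => x z [/= /XB Bx [i _ <-]]; rewrite gapE subr_ge0.
exact: surplus_le.
Qed.

Let measurable_gap : measurable_fun (column B `*` range y) gap.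
Proof.
have mR := range_ord_measurable y.
apply: measurable_funB.
  apply: measurable_funB.
    apply: measurable_funD => //; apply: measurable_funS mcost; first exact: measurableX.
    by move=> [x z] [/= Bx /rangeY].
  apply: measurable_funD => //; apply: (@measurable_comp _ _ _ _ _ _ (range y)) => //.
  - by move=> _ [[x z] [/= _ rz] <-].
  - by apply: within_measurable_space => //; exact: sigma_range.
  - by apply: measurable_funTS; exact: measurable_snd.
apply: measurable_funD => //; apply: (@measurable_comp _ _ _ _ _ _ (column B)) => //.
- by move=> _ [[x z] [/= Bx _] <-].
- exact: measurable_surplus.
- by apply: measurable_funTS; exact: measurable_fst.
Qed.

Let subgraph_col f : subgraph B f `<=` column B.
Proof. by move=> x [Bx /andP[]]. Qed.

Let mh : measurable_fun B h.
Proof. exact: (measurable_height B_compact c_lipschitz c_increasing yY). Qed.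

Let mXh : measurable (subgraph B h). Proof. exact: measurable_subgraph. Qed.

Hypothesis h_density : ac_density B h.

Let subgraph_mass f : ac_density B f -> Leb (subgraph B f) = 1%E.
Proof. by move=> [mf f0 f1]; rewrite lebesgue_subgraph. Qed.

Let measurable_surplusK X : X `<=` column B -> measurable X ->
  measurable_fun X (fun x => (surplus x + K)%:E).
Proof.
move=> XB mX; apply/measurable_EFinP; apply: measurable_funD => //.
exact: measurable_funS measurable_surplus.
Qed.

(* The bound holds off the graph of the height only: the surplus may be positive
   where the height vanishes. *)
Let surplus_below X : X `<=` subgraph B h -> measurable X ->
  (\int[Leb]_(x in X) (surplus x + K)%:E <= K%:E * Leb X)%E.
Proof.
move=> Xh mX; pose N := [set x : E | B x.1 /\ x.2 = h x.1].
have mN : measurable N by exact: measurable_graph.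
have N0 : Leb N = 0%E by exact: lebesgue_graph.
rewrite -(integral_cst _ mX).
rewrite [leLHS](integral_setD_null _ _ mN N0) [leRHS](integral_setD_null _ _ mN N0).
apply: ge0_le_integral.
- exact: measurableD.
- by move=> x [/Xh/subgraph_col Bx _]; rewrite lee_fin surplusK_ge0.
- by apply: measurable_surplusK; [move=> x [/Xh/subgraph_col]|exact: measurableD].
- exact: measurable_cst.
- move=> [s p] [/Xh[/= Bs /andP[p0 ph]] Ns]; rewrite lee_fin gerDr.
  apply: ltW; apply: surplus_lt0 => //; rewrite lt_neqAle ph andbT.
  by apply/eqP => pE; apply: Ns.
Qed.

(** The subgraph of the height keeps the places of negative surplus and discards
    those of nonnegative surplus, hence the bathtub principle: among the sets of mass
    1 it has the least total surplus. *)
Lemma bathtub f : ac_density B f ->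
  (\int[Leb]_(x in subgraph B h) (surplus x + K)%:E <=
   \int[Leb]_(x in subgraph B f) (surplus x + K)%:E)%E.
Proof.
move=> fd; have [mf _ _] := fd.
have mXf : measurable (subgraph B f) by exact: measurable_subgraph.
have split X X' : X `<=` column B -> measurable X -> measurable X' ->
    (\int[Leb]_(x in X) (surplus x + K)%:E = \int[Leb]_(x in X `&` X') (surplus x + K)%:E +
    \int[Leb]_(x in X `\` X') (surplus x + K)%:E)%E.
  move=> XB mX mX'; rewrite -[in LHS](setUIDK X X') ge0_integral_setU//.
  - exact: measurableI.
  - exact: measurableD.
  - by rewrite setUIDK; exact: measurable_surplusK.
  - by move=> x; rewrite setUIDK => /XB Bx; rewrite lee_fin surplusK_ge0.
  - by apply/disj_setPS; move=> x [[_ X'x] [_ /(_ X'x)]].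
rewrite (split (subgraph B h) (subgraph B f))// (split (subgraph B f) (subgraph B h))//.
rewrite setIC leeD2l//.
have mhf : measurable (subgraph B h `\` subgraph B f) by exact: measurableD.
have mfh : measurable (subgraph B f `\` subgraph B h) by exact: measurableD.
have mass : Leb (subgraph B h `\` subgraph B f) = Leb (subgraph B f `\` subgraph B h).
  have diffE A A' : measurable A -> measurable A' -> Leb A = 1%E ->
      Leb (A `\` A') = (1 - Leb (A `&` A'))%E.
    by move=> mA mA' A1; rewrite -A1; apply: measureD => //; rewrite [ltLHS]A1 ltry.
  have hE := diffE _ _ mXh mXf (subgraph_mass h_density).
  have fE := diffE _ _ mXf mXh (subgraph_mass fd).
  by rewrite [LHS]hE [RHS]fE setIC.
have sub : subgraph B h `\` subgraph B f `<=` subgraph B h by move=> x [].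
apply: le_trans (surplus_below sub mhf) _.
rewrite [X in (_ * X)%E]mass -[X in (X <= _)%E](integral_cst _ mfh).
apply: ge0_le_integral => //.
- by apply: measurable_surplusK => //; move=> x [/subgraph_col].
- move=> [s p] [[/= Bs /andP[p0 pf]] nh]; rewrite lee_fin lerDr.
  apply: surplus_ge0 => //; rewrite leNgt; apply/negP => ph; apply: nh.
  by split => //=; rewrite p0 ltW.
Qed.

Let V_fin : V (subgraph B h) \is a fin_num.
Proof.
rewrite /V fin_numD /= ge0_fin_numE.
  apply: le_lt_trans (surplus_below (@subset_refl _ _) mXh) _.
  by rewrite [X in (_ * X)%E](subgraph_mass h_density) mule1 ltry.
by apply: integral_ge0 => x /subgraph_col Bx; rewrite lee_fin surplusK_ge0.
Qed.

Lemma coupling_ge f g : ac_density B f -> coupling (subgraph B f) nu g ->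
  (V (subgraph B h) <= \int[g]_(w in column B `*` Y) (c w.1 w.2)%:E + (K + K)%:E)%E.
Proof.
move=> fd gf; have [mf _ _] := fd.
rewrite (coupling_gap (measurable_subgraph mB mf) (@subgraph_col f) gf).
apply: (@le_trans _ _ (V (subgraph B f))); first by rewrite /V leeD2l// bathtub.
by rewrite leeDl// integral_ge0// => w /(gap_ge0 (@subgraph_col f)); rewrite lee_fin.
Qed.

Let transport_range T : transport_map (subgraph B h) Y nu T ->
  measurable (subgraph B h `&` T @^-1` (~` range y)) /\
  Leb (subgraph B h `&` T @^-1` (~` range y)) = 0%E.
Proof.
move=> [mT _ Tnu]; have mR : measurable (~` range y).
  by apply: measurableC; exact: range_ord_measurable.
by split; [exact: mT|rewrite Tnu//; exact: atomic_rangeC].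
Qed.

(** Along a transport map, the gap compares the target used with the cheapest one. *)
Lemma transport_gap T : transport_map (subgraph B h) Y nu T ->
  (exists2 g, coupling (subgraph B h) nu g &
    \int[g]_(w in column B `*` Y) (c w.1 w.2)%:E =
      \int[Leb]_(x in subgraph B h) (c x (T x))%:E)%E /\
  (\int[Leb]_(x in subgraph B h) (c x (T x))%:E + (K + K)%:E = V (subgraph B h) +
    \int[Leb]_(x in subgraph B h) (gap (x, T x))%:E)%E.
Proof.
move=> tT; have [mT TY Tnu] := tT; have [mN N0] := transport_range tT.
have tT' : transport_map (subgraph B h) (range y) nu T.
  split => //; exists (subgraph B h `&` T @^-1` (~` range y)); split => // x /= nx.
  by have [Xx nR] := (not_implyP _ _).1 nx.
have [g gh gE] := transport_coupling mXh tT'.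
have costE : (\int[g]_(w in column B `*` Y) (c w.1 w.2)%:E =
    \int[Leb]_(x in subgraph B h) (c x (T x))%:E)%E.
  apply: (gE (column B `*` Y) (fun w => (c w.1 w.2)%:E)).
  - exact: measurableX.
  - exact/measurable_EFinP.
  - by move=> [x z] [/= Bx Yz]; rewrite lee_fin; exact: c_ge0.
  - by move=> x /subgraph_col Bx /rangeY YT; split.
split; first by exists g.
rewrite -costE (coupling_gap mXh (@subgraph_col h) gh); congr (_ + _)%E.
apply: (gE (subgraph B h `*` range y) (fun w => (gap w)%:E)).
- by apply: measurableX => //; exact: range_ord_measurable.
- apply/measurable_EFinP; apply: measurable_funS measurable_gap.
    by apply: measurableX => //; exact: range_ord_measurable.
  by move=> [x z] [/= /subgraph_col].
- by move=> w /(gap_ge0 (@subgraph_col h)); rewrite lee_fin.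
- by [].
Qed.

Section cheapest_map.
Variable T : E -> E.
Hypothesis T_transport : transport_map (subgraph B h) Y nu T.
Hypothesis T_cheapest : {ae Leb, forall x, subgraph B h x ->
  exists2 i, T x = y i & surplus x = c x (y i) - sg i}.

Let T_cost : (\int[Leb]_(x in subgraph B h) (c x (T x))%:E + (K + K)%:E =
  V (subgraph B h))%E.
Proof.
have [_ ->] := transport_gap T_transport; rewrite -[RHS]adde0; congr (_ + _)%E.
have [N [mN N0 TN]] := T_cheapest.
rewrite (integral_setD_null _ _ mN N0) integral0_eq// => x [Xx Nx].
have [i -> si] : exists2 i, T x = y i & surplus x = c x (y i) - sg i.
  by apply: contrapT => H; apply: Nx; apply: TN => /(_ Xx).
by rewrite gapE si subrr.
Qed.

(** The cost of a cheapest map attains the lower bound which holds for the couplings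
    of all the densities. *)
Lemma height_minimises : minimises B Y c nu h.
Proof.
split; first exact: h_density.
move=> f fd; apply: (@le_trans _ _ (\int[Leb]_(x in subgraph B h) (c x (T x))%:E)%E).
  have [[g gh <-] _] := transport_gap T_transport.
  by apply: ereal_inf_lbound; exists g.
apply: le_ereal_inf_tmp => _ [g gf <-]; rewrite -(@leeD2rE _ (K + K)%:E)// T_cost.
exact: (coupling_ge fd).
Qed.

Lemma cheapest_map_optimal : optimal_transport_map (subgraph B h) Y c nu T.
Proof.
split; first exact: T_transport.
move=> T' tT'; rewrite -(@leeD2rE _ (K + K)%:E)// T_cost.
by have [[g gh <-] _] := transport_gap tT'; exact: (coupling_ge h_density).
Qed.

(** An optimal map has the cost of T, so its gap has integral 0. *)
Lemma optimal_map_cheapest T' : optimal_transport_map (subgraph B h) Y c nu T' ->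
  {ae Leb, forall x, subgraph B h x ->
    exists2 i, T' x = y i & surplus x = c x (y i) - sg i}.
Proof.
move=> [tT' T'opt]; have [mT' _ _] := tT'; have [mN N0] := transport_range tT'.
have [_ gapT'] := transport_gap tT'.
set N := subgraph B h `&` T' @^-1` (~` range y) in mN N0.
have gap0 : (\int[Leb]_(x in subgraph B h) (gap (x, T' x))%:E = 0)%E.
  have := T'opt _ T_transport; rewrite -(@leeD2rE _ (K + K)%:E)// T_cost gapT'.
  rewrite -[leRHS]adde0 leeD2lE// => gle; apply/eqP; rewrite eq_le gle/=.
  rewrite (integral_setD_null _ _ mN N0) integral_ge0// => x Dx; rewrite lee_fin.
  apply: (gap_ge0 (@subgraph_col h)); split; first exact: Dx.1.
  by apply: contrapT => nR; apply: Dx.2; split => //; exact: Dx.1.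
rewrite (integral_setD_null _ _ mN N0) in gap0.
have mD : measurable (subgraph B h `\` N) by exact: measurableD.
have DR x : (subgraph B h `\` N) x -> range y (T' x).
  by move=> [Xx Nx]; apply: contrapT => nR; exact: Nx.
have mg : measurable_fun (subgraph B h `\` N) (fun x => (gap (x, T' x))%:E).
  apply/measurable_EFinP.
  apply: (@measurable_comp _ _ _ _ _ _ (column B `*` range y) gap) => //.
  - by apply: measurableX => //; exact: range_ord_measurable.
  - by move=> _ [x Dx <-]; split => /=; [exact: subgraph_col Dx.1|exact: DR].
  - by apply: measurable_graph_map => //; exact: measurable_funS mT'.
have [+ _] := ae_eq_integral_abs Leb mD mg.
rewrite (_ : integral _ _ _ = 0%E); last first.
  rewrite -gap0; apply: eq_integral => x /set_mem Dx.
  by rewrite gee0_abs// lee_fin; apply: (gap_ge0 (@subgraph_col h)); split; [exact: Dx.1|exact: DR].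
move=> /(_ erefl) [M [mM M0 gM]]; exists (M `|` N); split; first exact: measurableU.
  exact: null_set_setU.
move=> x /= /not_implyP[Xx Tx]; apply: contrapT => /not_orP[Mx Nx]; apply: Tx.
have [i _ yi] := DR x (conj Xx Nx); exists i => //.
have : gap (x, T' x) = 0.
  have : ((subgraph B h `\` N) x -> (gap (x, T' x))%:E = cst 0%E x).
    by apply: contrapT => H; apply: Mx; exact: gM.
  by move=> /(_ (conj Xx Nx)) [].
by rewrite -yi gapE => /eqP; rewrite subr_eq0 => /eqP ->.
Qed.

End cheapest_map.

End optimality.

(** * Laguerre cells *)

Section almost_disjoint.
Context d (T : measurableType d) (R : realType) (mu : {measure set T -> \bar R}).

Lemma measure_setD_null (A N : set T) : measurable A -> measurable N ->
  mu N = 0%E -> mu (A `\` N) = mu A.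
Proof.
move=> mA mN N0; rewrite [RHS](measureDI mu mA mN).
rewrite [X in (_ = _ + X)%E](_ : _ = 0%E) ?adde0//.
by apply: subset_measure0 N0 => //; exact: measurableI.
Qed.

Lemma measure_bigsetU_null (I : Type) (s : seq I) (A : I -> set T) :
  (forall i, measurable (A i)) -> (forall i, mu (A i) = 0%E) ->
  mu (\big[setU/set0]_(i <- s) A i) = 0%E.
Proof.
move=> mA A0.
have [_ //] : measurable (\big[setU/set0]_(i <- s) A i) /\
    mu (\big[setU/set0]_(i <- s) A i) = 0%E.
apply: (big_ind (fun S => measurable S /\ mu S = 0%E)) => //.
  by move=> S S' [mS S0] [mS' S'0]; split; [exact: measurableU|exact: null_set_setU].
Qed.

Lemma almost_disjoint_sum (I : finType) (A : I -> set T) :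
  (forall i, measurable (A i)) ->
  (forall i j, i != j -> mu (A i `&` A j) = 0%E) ->
  mu (\big[setU/set0]_i A i) = (\sum_i mu (A i))%E.
Proof.
move=> mA A0; have := index_enum_uniq I; elim: (index_enum I) => [_|i s IH /= /andP[ni us]].
  by rewrite !big_nil measure0.
rewrite !big_cons -IH//; set U := \big[setU/set0]_(j <- s) A j.
have mU : measurable U by exact: bigsetU_measurable.
have iU0 : mu (A i `&` U) = 0%E.
  rewrite /U big_distrr/= big_seq_cond.
  rewrite (eq_bigr (fun j => if j == i then set0 else A i `&` A j)); last first.
    by move=> j; rewrite andbT => js; case: eqP => // ji; move: ni; rewrite -ji js.
  rewrite -big_seq_cond; apply: measure_bigsetU_null => j.
    by case: eqP => // _; exact: measurableI.
  by case: eqP => // /eqP ji; rewrite A0// eq_sym.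
have -> : A i `|` U = A i `|` (U `\` (A i `&` U)).
  apply/seteqP; split => x [Ax|Ux]; try by left.
    have [Ax|nAx] := pselect (A i x); first by left.
    by right; split => // -[].
  by right; exact: Ux.1.
rewrite measureU//; last 2 first.
- by apply: measurableD => //; exact: measurableI.
- by apply/seteqP; split => x // [Ax [Ux]]; exact.
by congr (_ + _)%E; apply: measure_setD_null => //; exact: measurableI.
Qed.

(** Almost disjointness bounds the sum of the masses by the mass of D, which is the
    sum of the lower bounds. *)
Lemma almost_partition_mass (I : finType) (A : I -> set T) (D : set T) (w : I -> R) :
  (forall i, measurable (A i)) -> measurable D -> (forall i, A i `<=` D) ->
  (forall i j, i != j -> mu (A i `&` A j) = 0%E) ->
  (forall i, ((w i)%:E <= mu (A i))%E) -> mu D = (\sum_i w i)%:E ->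
  forall i, mu (A i) = (w i)%:E.
Proof.
move=> mA mD AD A0 wA DE.
have Afin i : mu (A i) \is a fin_num.
  rewrite ge0_fin_numE//; apply: (@le_lt_trans _ _ (mu D)); last by rewrite DE ltry.
  by apply: le_measure; rewrite ?inE.
have tot : \sum_i fine (mu (A i)) <= \sum_i w i.
  rewrite -lee_fin -DE -sumEFin; under eq_bigr do rewrite fineK//.
  rewrite -almost_disjoint_sum//; apply: le_measure; rewrite ?inE//.
    exact: bigsetU_measurable.
  by rewrite -bigcup_seq => x [i _]; exact: AD.
move=> i; rewrite -[LHS]fineK//; congr EFin; apply/eqP; rewrite eq_le; apply/andP; split.
  move: tot; rewrite (bigD1 i)//= [leRHS](bigD1 i)//=.
  have : \sum_(j | j != i) w j <= \sum_(j | j != i) fine (mu (A j)).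
    by apply: ler_sum => j _; rewrite -lee_fin fineK.
  by lra.
by rewrite -lee_fin fineK.
Qed.

End almost_disjoint.

Section cells.
Context (R : realType) (d n : nat).
Local Notation E := (Rspace R d).
Local Notation Leb := (@lebesgue_space R d).
Local Notation lam := (lebesgue_rV d.-1).
Variables (B : set 'rV[R]_d.-1) (Y : set E) (c : E -> E -> R).
Hypotheses (B_compact : compact B) (Y_compact : compact Y).
Hypothesis c_ge0 : nonneg_cost B Y c.
Hypothesis c_lipschitz : cost_lipschitz B Y c.
Hypothesis c_increasing : cost_increasing B Y c.
Hypothesis c_twist : extended_twist B Y c.
Variables (y : 'I_n -> E) (m : 'I_n -> R) (sigma : E -> R) (P : R).
Hypotheses (yY : forall i, Y (y i)) (y_inj : injective y).
Hypothesis m_sum : \sum_i m i = 1.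
Hypothesis sigma_cont : {within Y, continuous sigma}.

Let sg i := sigma (y i).
Let h := height c y sg.
Let D := truncated_column B P.

(** The cells of the targets y_i, and that of the dummy target, whose price is
    normalised to 0. *)
Definition target_cell i := D `&` [set x | c x (y i) - sg i <= 0 /\
  forall j, c x (y i) - sg i <= c x (y j) - sg j].

Definition dummy_cell := D `&` [set x | forall j, 0 <= c x (y j) - sg j].

Let D_col : D `<=` column B. Proof. by move=> x [Bx /andP[]]. Qed.

Let mB : measurable B.
Proof. exact: closed_measurable_rV (compact_closed_rV B_compact). Qed.

Let mD : measurable D.
Proof.
by apply: (@measurable_subgraph _ _ _ mB (cst P)); exact: measurable_cst.
Qed.

Let mc i : measurable_fun D (fun x => c x (y i) - sg i).
Proof.
apply: measurable_funB => //; apply: within_measurable_space => //.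
exact: (cost_within1 c_lipschitz).
Qed.

Let measurable_forall (f g : 'I_n -> E -> R) :
  (forall j, measurable_fun D (f j)) -> (forall j, measurable_fun D (g j)) ->
  measurable (D `&` [set x | forall j, f j x <= g j x]).
Proof.
move=> mf mg; rewrite (_ : _ `&` _ = D `&`
    \big[setI/setT]_(j < n) (D `&` [set x | f j x <= g j x])).
  by apply: measurableI => //; apply: bigsetI_measurable => j _; exact: measurable_fun_le.
rewrite -bigcap_seq; apply/seteqP; split => x [Dx /= hx]; split => //=.
  by move=> j _; split => //=.
by move=> j; have [] := hx j (mem_index_enum _).
Qed.

Lemma measurable_target_cell i : measurable (target_cell i).
Proof.
rewrite (_ : target_cell i = (D `&` [set x | c x (y i) - sg i <= 0]) `&`
    (D `&` [set x | forall j, c x (y i) - sg i <= c x (y j) - sg j])).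
  apply: measurableI; last exact: measurable_forall.
  by apply: measurable_fun_le => //; exact: mc.
by apply/seteqP; split => [x [Dx []]|x [[Dx ?] []]].
Qed.

Lemma measurable_dummy_cell : measurable dummy_cell.
Proof. by apply: (@measurable_forall (fun _ => cst 0)). Qed.

Lemma target_cells_null i j : i != j -> Leb (target_cell i `&` target_cell j) = 0%E.
Proof.
move=> ij; apply: (@subset_measure0 _ _ _ Leb _
  [set x | D x /\ c x (y i) - c x (y j) = sg i - sg j]).
- by apply: measurableI; exact: measurable_target_cell.
- exact: (measurable_tie c_lipschitz).
- move=> x [[Dx [_ hi]] [_ [_ hj]]]; split => //; have := hi j; have := hj i; lra.
- apply: (tie_null c_lipschitz c_twist) => //.
  by move=> /y_inj yij; move: ij; rewrite yij eqxx.
Qed.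

Lemma dummy_cell_null i : Leb (target_cell i `&` dummy_cell) = 0%E.
Proof.
have [mL L0] := level_null (sg i) c_lipschitz c_increasing mD D_col (yY i).
apply: subset_measure0 L0 => //.
  by apply: measurableI; [exact: measurable_target_cell|exact: measurable_dummy_cell].
by move=> x [[Dx [h1 _]] [_ /(_ i) h2]]; split => //; lra.
Qed.

Lemma dummy_cellE : dummy_cell = D `&` [set x | h x.1 <= x.2].
Proof.
apply/seteqP; split => -[s p] [[/= Bs /andP[p0 pP]] /= hx]; split; rewrite /D /truncated_column /= ?p0//.
  by apply/(height_leP c_lipschitz c_increasing yY sg Bs p0) => j; rewrite -subr_ge0.
move=> j; rewrite subr_ge0.
exact: (height_leP c_lipschitz c_increasing yY sg Bs p0).1.
Qed.

(** The mass outside the dummy cell lies under the graph of the height truncated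
    at P. *)
Lemma dummy_cell_mass : 0 <= P -> Leb D = P%:E -> Leb dummy_cell = (P - 1)%:E ->
  (\int[lam]_(s in B) (Num.min (h s) P)%:E = 1)%E.
Proof.
move=> P0 DP dP; have mh : measurable_fun B h.
  exact: (measurable_height B_compact c_lipschitz c_increasing yY).
have mmin : measurable_fun B (fun s => Num.min (h s) P) by exact: measurable_minr.
rewrite -lebesgue_subgraph//; last first.
  by move=> s Bs; rewrite le_min P0 andbT; exact: (height_ge0 c_increasing yY).
rewrite -(measure_setD_null (measurable_subgraph mB mmin) (measurable_graph mB mh)
  (lebesgue_graph mB mh)).
have mdum := measurable_dummy_cell.
transitivity (Leb (D `\` dummy_cell)).
  congr (Leb _); rewrite dummy_cellE; apply/seteqP; split => -[s p] [] /=.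
    move=> [/= Bs]; rewrite le_min => /and3P[p0 ph pP] nN; split.
      by split => //=; rewrite p0 pP.
    by move=> [_ /= hp]; apply: nN; split => //; apply/eqP; rewrite eq_le ph hp.
  move=> [/= Bs /andP[p0 pP]] nd; have hp : p < h s.
    by rewrite ltNge; apply/negP => hp; apply: nd; split => //; split => //=; rewrite p0 pP.
  split; first by split => //=; rewrite p0 le_min ltW.
  by move=> [_ /= pE]; move: hp; rewrite pE ltxx.
rewrite measureD//; last by rewrite [X in (X < _)%E]DP ltry.
rewrite setIidr; last by move=> x [].
by rewrite [X in (X - _)%E]DP [X in (_ - X)%E]dP -EFinB; congr EFin; lra.
Qed.

Hypothesis h_density : ac_density B h.
Hypothesis h_lt : forall s, B s -> h s < P.
Hypothesis cell_mass : forall i, Leb (target_cell i) = (m i)%:E.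

Let X := subgraph B h.

Let mh : measurable_fun B h. Proof. by case: h_density. Qed.

Let mX : measurable X. Proof. exact: measurable_subgraph. Qed.

(* Off this null set, a point under the graph of the height lies in exactly one
   cell. *)
Let N : set E := [set x | B x.1 /\ x.2 = h x.1] `|`
  \big[setU/set0]_(ij : 'I_n * 'I_n)
    (if ij.1 == ij.2 then set0 else target_cell ij.1 `&` target_cell ij.2).

Let mtie (ij : 'I_n * 'I_n) : measurable
  (if ij.1 == ij.2 then set0 else target_cell ij.1 `&` target_cell ij.2).
Proof. by case: eqP => // _; apply: measurableI; exact: measurable_target_cell. Qed.

Let mN : measurable N.
Proof.
by apply: measurableU; [exact: measurable_graph|exact: bigsetU_measurable].
Qed.

Let N0 : Leb N = 0%E.
Proof.
apply: null_set_setU.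
- exact: measurable_graph.
- exact: bigsetU_measurable.
- exact: lebesgue_graph.
- apply: measure_bigsetU_null => // ij.
  by case: eqP => // /eqP; exact: target_cells_null.
Qed.

Definition cell_map x := \sum_(i < n) \1_(target_cell i) x *: y i.

Let cell_map_eq x i : ~ N x -> target_cell i x -> cell_map x = y i.
Proof.
move=> Nx Cix; rewrite /cell_map (bigD1 i)//= indicE mem_set// scale1r big1 ?addr0// => j ji.
rewrite indicE memNset ?scale0r// => Cjx; apply: Nx; right.
by rewrite (bigD1 (j, i))//=; left; rewrite (negbTE ji).
Qed.

Let cheapest_cell x i : X x -> ~ N x -> surplus c y sigma x = c x (y i) - sg i ->
  target_cell i x.
Proof.
case: x => s p [/= Bs /andP[p0 ph]] Nx si.
have Dx : D (s, p) by split => //=; rewrite p0 (le_trans ph)// ltW// h_lt.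
have Bx := D_col Dx; split => //; split.
  rewrite -si; apply: ltW.
  apply: (surplus_lt0 c_ge0 c_lipschitz c_increasing yY sigma_cont) => //.
  by rewrite lt_neqAle ph andbT; apply/eqP => pE; apply: Nx; left.
by move=> j; rewrite -si; exact: (surplus_le c_ge0 yY sigma_cont).
Qed.

Let cell_sub i : target_cell i `<=` X.
Proof.
move=> [s p] [[/= Bs /andP[p0 pP]] [/= ci _]]; split => //=; rewrite p0/= leNgt.
apply/negP => hp; have p_gt0 : 0 < p by exact: le_lt_trans (height_ge0 c_increasing yY sg Bs) hp.
have := (height_ltP c_lipschitz c_increasing yY sg Bs p_gt0).1 hp i.
by rewrite ltNge -subr_le0 ci.
Qed.

Let cheapest_exists x : X x ->
  exists i, surplus c y sigma x = c x (y i) - sg i.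
Proof.
move=> [Bx /andP[x0 _]]; have colx : column B x by [].
have [i0 _] : exists i0 : 'I_n, true.
  apply: contrapT => nI; move: m_sum; rewrite big1 => [/esym/eqP|i _].
    by rewrite oner_eq0.
  by exfalso; apply: nI; exists i.
have [i _ imin] := @arg_minP _ _ _ i0 xpredT (fun i => c x (y i) - sg i) isT.
exists i; apply/eqP; rewrite eq_le (surplus_le c_ge0 yY sigma_cont)//=.
by apply: (surplus_ge m_sum) => j; exact: imin.
Qed.

Lemma cell_map_cheapest : {ae Leb, forall x, X x ->
  exists2 i, cell_map x = y i & surplus c y sigma x = c x (y i) - sg i}.
Proof.
exists N; split => // x /= /not_implyP[Xx nE]; apply: contrapT => Nx; apply: nE.
have [i si] := cheapest_exists Xx; exists i => //.
by apply: cell_map_eq => //; exact: cheapest_cell.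
Qed.

Lemma cell_map_transport : transport_map X Y (atomic y m) cell_map.
Proof.
have mT : measurable_fun setT cell_map.
  have mi i : measurable_fun setT (\1_(target_cell i) : E -> R).
    by apply: measurable_indic; exact: measurable_target_cell.
  apply/measurable_fun_pairP; split.
    apply: measurable_fun_rV => k.
    rewrite (_ : (fun _ => _) = (fun x => \sum_i (\1_(target_cell i) x) * (y i).1 0 k)).
      by apply: measurable_sum => i; exact: measurable_funM.
    apply/funext => x; rewrite /cell_map /=.
    rewrite (big_morph (fun z : E => z.1 0 k) (id1 := 0) (op1 := +%R)).
    - by apply: eq_bigr => i _; rewrite /= !mxE.
    - by move=> a b /=; rewrite mxE.
    - by rewrite /= mxE.
  rewrite (_ : _ \o _ = (fun x => \sum_i (\1_(target_cell i) x) * (y i).2)).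
    by apply: measurable_sum => i; exact: measurable_funM.
  apply/funext => x; rewrite /cell_map /=.
  by rewrite (big_morph (fun z : E => z.2) (id1 := 0) (op1 := +%R)).
split.
- exact: measurable_funTS.
- by apply: filterS cell_map_cheapest => x h1 /h1[i -> _].
move=> A mA; pose CA i := if y i \in A then target_cell i else set0.
have mCA i : measurable (CA i).
  by rewrite /CA; case: ifP => // _; exact: measurable_target_cell.
have mXA : measurable (X `&` cell_map @^-1` A).
  by apply: measurableI => //; rewrite -[S in measurable S]setTI; exact: mT.
rewrite -(measure_setD_null mXA mN N0).
transitivity (Leb ((\big[setU/set0]_i CA i) `\` N)).
  congr (Leb _); apply/seteqP; split => x [] /=.
    move=> [Xx TA] Nx; split => //; have [i si] := cheapest_exists Xx.
    have Cix := cheapest_cell Xx Nx si.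
    rewrite (bigD1 i)//=; left; rewrite /CA mem_set//.
    by rewrite -(cell_map_eq Nx Cix).
  rewrite -bigcup_seq => -[i _]; rewrite /CA; case: ifPn => // /set_mem yA Cix Nx.
  split => //; split; first exact: cell_sub Cix.
  by rewrite /= (cell_map_eq Nx Cix).
rewrite measure_setD_null//; last exact: bigsetU_measurable.
rewrite almost_disjoint_sum//; last first.
  move=> i j ij; rewrite /CA; case: ifP => _; last by rewrite set0I measure0.
  by case: ifP => _; [exact: target_cells_null|rewrite setI0 measure0].
rewrite /atomic; apply: eq_bigr => i _; rewrite /CA diracE.
by case: ifP => _; [rewrite mule1; exact: cell_mass|rewrite measure0 mule0].
Qed.

(** The cell map exhibits a coupling without gap for the subgraph of the height. *)
Lemma height_continuous_minimiser : continuous_minimiser B Y c (atomic y m) h.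
Proof.
split; first exact: (height_within_continuous c_lipschitz c_increasing yY).
exact: (height_minimises B_compact Y_compact c_ge0 c_lipschitz c_increasing
  yY y_inj m_sum sigma_cont h_density cell_map_transport cell_map_cheapest).
Qed.

Lemma cell_map_optimal : optimal_transport_map X Y c (atomic y m) cell_map.
Proof.
exact: (cheapest_map_optimal B_compact Y_compact c_ge0 c_lipschitz c_increasing
  yY y_inj m_sum sigma_cont h_density cell_map_transport cell_map_cheapest).
Qed.

Lemma optimal_map_unique T : optimal_transport_map X Y c (atomic y m) T ->
  {ae Leb, forall x, X x -> T x = cell_map x}.
Proof.
move=> Topt.
have [M [mM M0 TM]] : {ae Leb, forall x, X x ->
    exists2 i, T x = y i & surplus c y sigma x = c x (y i) - sg i}.
  exact: (optimal_map_cheapest B_compact Y_compact c_ge0 c_lipschitz c_increasing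
    yY y_inj m_sum sigma_cont h_density cell_map_transport cell_map_cheapest).
exists (M `|` N); split; [exact: measurableU|exact: null_set_setU|].
move=> x /= /not_implyP[Xx nE]; apply: contrapT => /not_orP[Mx Nx]; apply: nE.
have [i -> si] : exists2 i, T x = y i & surplus c y sigma x = c x (y i) - sg i.
  by apply: contrapT => H; apply: Mx; apply: TM => /(_ Xx).
by apply/esym/cell_map_eq => //; exact: cheapest_cell.
Qed.

End cells.

(** * The extended problem *)

Section extended.
Context (R : realType) (d n : nat).
Local Notation E := (Rspace R d).
Local Notation Leb := (@lebesgue_space R d).
Variables (B : set 'rV[R]_d.-1) (Y : set E) (c : E -> E -> R).
Hypotheses (B_compact : compact B) (Y_compact : compact Y).
Hypothesis c_ge0 : nonneg_cost B Y c.
Hypothesis c_lipschitz : cost_lipschitz B Y c.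
Hypothesis c_increasing : cost_increasing B Y c.
Hypothesis c_twist : extended_twist B Y c.
Variables (y : 'I_n -> E) (m : 'I_n -> R).
Hypotheses (yY : forall i, Y (y i)) (y_inj : injective y).
Hypothesis m_sum : \sum_i m i = 1.
Variables (P : R) (yext : E) (nu_ext : {measure set E -> \bar R}) (psi : E -> R).
Hypotheses (P_gt0 : 0 < P) (yextNY : ~ Y yext).
Hypothesis nu_extE : forall A, measurable A ->
  nu_ext A = (atomic y m A + (P - 1)%:E * \d_yext A)%E.

Let D := truncated_column B P.
Let Z := Y `|` [set yext].
Let ce := cost_ext c yext.

Hypothesis psi_potential : kantorovich_potential D Z ce nu_ext psi.

Let sigma z := psi z - psi yext.

Let D_col : D `<=` column B. Proof. by move=> x [Bx /andP[]]. Qed.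

Let mB : measurable B.
Proof. exact: closed_measurable_rV (compact_closed_rV B_compact). Qed.

Let mD : measurable D.
Proof. by apply: (@measurable_subgraph _ _ _ mB (cst P)); exact: measurable_cst. Qed.

Let DE : Leb D = (P%:E * lebesgue_rV d.-1 B)%E.
Proof. by apply: lebesgue_truncated_column => //; exact: ltW. Qed.

Let D_fin : (Leb D < +oo)%E.
Proof.
rewrite [X in (X < _)%E]DE; apply: lte_mul_pinfty => //.
  by rewrite lee_fin ltW.
exact: lebesgue_rV_compact_lty.
Qed.

Let Z_compact : compact Z.
Proof. by apply: compactU => //; exact: compact_set1. Qed.

Let mZ : measurable Z.
Proof. by apply: closed_measurable_space; exact: compact_closed_space. Qed.

Let nu_Z : nu_ext Z = P%:E.
Proof.
rewrite nu_extE// diracE mem_set; last by right.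
rewrite mule1 (_ : atomic y m Z = 1%E); first by rewrite -EFinD; congr EFin; lra.
rewrite /atomic -m_sum -sumEFin; apply: eq_bigr => i _.
by rewrite diracE mem_set ?mule1//; left.
Qed.

Let ceY x z : Y z -> ce x z = c x z.
Proof. by move=> Yz; rewrite /ce /cost_ext; case: eqP => // zE; move: Yz; rewrite zE. Qed.

Let ce_yext x : ce x yext = 0. Proof. by rewrite /ce /cost_ext eqxx. Qed.

Let ce_ge0 x z : D x -> Z z -> 0 <= ce x z.
Proof.
by move=> /D_col Bx [Yz|->]; [rewrite ceY//; exact: c_ge0|rewrite ce_yext].
Qed.

Let ce_cont1 z : Z z -> {within D, continuous (ce^~ z)}.
Proof.
move=> [Yz|->].
  apply: (@subspace_eq_continuous _ _ _ (c^~ z)); first by move=> x _; exact/esym/ceY.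
  exact: (cost_within1 c_lipschitz).
apply: (@subspace_eq_continuous _ _ _ (cst 0)); first by move=> x _; exact/esym/ce_yext.
by move=> x; exact: cst_continuous.
Qed.

(* yext is isolated from the closed set Y. *)
Let ce_cont2 x : D x -> {within Z, continuous (ce x)}.
Proof.
move=> /D_col Bx; apply: withinU_continuous.
- exact: compact_closed_space.
- by apply: compact_closed_space; exact: compact_set1.
- apply: (@subspace_eq_continuous _ _ _ (c x)); first by move=> z /set_mem Yz; exact/esym/ceY.
  exact: (cost_within2 c_lipschitz).
- apply: (@subspace_eq_continuous _ _ _ (cst 0)).
    by move=> z /set_mem ->; exact/esym/ce_yext.
  by move=> z; exact: cst_continuous.
Qed.

Let Zy i : Z (y i). Proof. by left. Qed.

Let Zyext : Z yext. Proof. by right. Qed.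

Let psi_cont : {within Z, continuous psi}. Proof. by case: psi_potential. Qed.

(** As D has volume P |B|, this forces B to have volume 1. *)
Lemma extended_mass : Leb D = P%:E.
Proof.
rewrite -nu_Z; apply/esym.
apply: (@potential_mass _ _ D Z ce nu_ext yext 0) => //.
- by rewrite nu_Z ltry.
- by move=> x _; rewrite ce_yext.
- exact: psi_potential.
Qed.

Lemma extended_atom z : Z z -> (nu_ext [set z] <= Leb (contact_set D Z ce psi z))%E.
Proof.
move=> Zz; apply: (@potential_atom_le _ _ D Z ce nu_ext yext 0) => //.
- by rewrite nu_Z ltry.
- by move=> x _; rewrite ce_yext.
Qed.

Lemma extended_price_continuous : {within Y, continuous sigma}.
Proof.
have cY : {within Y, continuous psi} by apply: continuous_subspaceW psi_cont => z; left.
by move=> z; apply: continuousB; [exact: cY|exact: cst_continuous].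
Qed.

Let yy := add_point y yext.
Let L := laguerre_cell D ce yy (fun i => psi (yy i)).

Let yy_lift i : yy (lift ord_max i) = y i.
Proof. by rewrite /yy /add_point liftK. Qed.

Let yy_max : yy ord_max = yext.
Proof. by rewrite /yy /add_point unlift_none. Qed.

Lemma laguerre_target i : L (lift ord_max i) = target_cell B c y sigma P i.
Proof.
apply/seteqP; split => x [Dx /=].
  rewrite yy_lift ceY// => h; split => //; split.
    by have := h ord_max; rewrite yy_max ce_yext /sigma; lra.
  by move=> j; have := h (lift ord_max j); rewrite yy_lift ceY// /sigma; lra.
move=> [hx hj]; split => // j; rewrite yy_lift ceY//.
have [k ->|->] := unliftP ord_max j.
  by rewrite yy_lift ceY//; have := hj k; rewrite /sigma; lra.
by rewrite yy_max ce_yext; move: hx; rewrite /sigma; lra.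
Qed.

Lemma laguerre_dummy : L ord_max = dummy_cell B c y sigma P.
Proof.
apply/seteqP; split => x [Dx /=].
  rewrite yy_max ce_yext => h; split => //= j.
  by have := h (lift ord_max j); rewrite yy_lift ceY// /sigma; lra.
move=> hj; split => // j; rewrite yy_max ce_yext.
have [k ->|->] := unliftP ord_max j; last by rewrite yy_max ce_yext.
by rewrite yy_lift ceY//; have := hj k; rewrite /sigma; lra.
Qed.

(* Mass m_i for the target y_i, and P - 1 for the dummy target. *)
Let weight (k : 'I_n.+1) := oapp m (P - 1) (unlift ord_max k).

Let Zyy k : Z (yy k).
Proof. by have [i ->|->] := unliftP ord_max k; rewrite ?yy_lift ?yy_max. Qed.

Let y_neq_yext i : y i <> yext.
Proof. by move=> yE; apply: yextNY; rewrite -yE. Qed.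

Let atom_mass k : nu_ext [set yy k] = (weight k)%:E.
Proof.
rewrite nu_extE; last exact: measurable_space1.
rewrite /weight; have [i ->|->] := unliftP ord_max k.
  rewrite /= yy_lift atomic_set1// diracE memNset ?mule0 ?adde0//.
  by move=> /= /esym; exact: y_neq_yext.
rewrite /= yy_max diracE mem_set// mule1 /atomic big1 ?add0e// => i _.
by rewrite diracE memNset ?mule0//; exact: y_neq_yext.
Qed.

Let weight_sum : \sum_k weight k = P.
Proof.
rewrite (bigD1_ord ord_max)//= /weight unlift_none /= (eq_bigr m) => [|i _]; last by rewrite liftK.
by rewrite m_sum; lra.
Qed.

Let contact_sub k : contact_set D Z ce psi (yy k) `<=` L k.
Proof.
move=> x [Dx /= hx]; split => // j; apply: le_trans hx _.
exact: (ctransform_le Z_compact ce_ge0 psi_cont Dx (Zyy j)).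
Qed.

Let measurable_laguerre k : measurable (L k).
Proof.
have [i ->|->] := unliftP ord_max k.
  by rewrite laguerre_target; exact: (measurable_target_cell B_compact c_lipschitz).
by rewrite laguerre_dummy; exact: (measurable_dummy_cell B_compact c_lipschitz).
Qed.

Lemma laguerre_mass k : Leb (L k) = (oapp m (P - 1) (unlift ord_max k))%:E.
Proof.
apply: (almost_partition_mass (D := D) (w := weight)) => //.
- by move=> i x [].
- move=> i j; have [i' ->|->] := unliftP ord_max i; have [j' ->|->] := unliftP ord_max j.
  + rewrite !laguerre_target => ij; apply: (target_cells_null B_compact c_lipschitz c_twist) => //.
    by apply: contraNneq ij => ->.
  + by move=> _; rewrite laguerre_target laguerre_dummy;
      exact: (dummy_cell_null B_compact c_lipschitz c_increasing sigma P yY).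
  + by move=> _; rewrite laguerre_target laguerre_dummy setIC;
      exact: (dummy_cell_null B_compact c_lipschitz c_increasing sigma P yY).
  + by rewrite eqxx.
- move=> i; rewrite -atom_mass; apply: le_trans (extended_atom (Zyy i)) _.
  apply: le_measure; rewrite ?inE//.
  exact: (measurable_contact_set mD Z_compact ce_ge0 ce_cont1 Zyext psi_potential (Zyy i)).
- by rewrite [LHS]extended_mass weight_sum.
Qed.

End extended.

Theorem corollary5p3 (R : realType) (d : nat) (d_ge2 : (2 <= d)%N)
  (B : set 'rV[R]_d.-1) (B_compact : compact B)
  (B_interior : interior B !=set0)
  (Y : set (Rspace R d)) (Y_nonempty : Y !=set0) (Y_compact : compact Y)
  (c : Rspace R d -> Rspace R d -> R)
  (c_ge0 : nonneg_cost B Y c)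
  (c_lipschitz : cost_lipschitz B Y c)
  (c_increasing : cost_increasing B Y c)
  (c_equicontinuous : cost_equicontinuous B Y c)
  (c_twist : extended_twist B Y c)
  (n : nat) (y : 'I_n -> Rspace R d) (yY : forall i, Y (y i))
  (y_distinct : injective y)
  (m : 'I_n -> R) (m_gt0 : forall i, 0 < m i) (m_sum : \sum_(i < n) m i = 1)
  (pbar : 'rV[R]_d.-1 -> R)
  (pbar_min : unique_continuous_minimiser B Y c (atomic y m) pbar)
  (P : R) (P_gt0 : 0 < P)
  (P_bound : forall f s, density_family B Y c f -> B s -> f s < P)
  (yext : Rspace R d) (yextNY : ~ Y yext)
  (nu_ext : {measure set (Rspace R d) -> \bar R})
  (nu_extE : forall A, measurable A ->
     nu_ext A = (atomic y m A + (P - 1)%:E * \d_yext A)%E)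
  (psi_ext : Rspace R d -> R)
  (psi_ext_potential : kantorovich_potential (truncated_column B P)
     (Y `|` [set yext]) (cost_ext c yext) nu_ext psi_ext) :
  let yy := add_point y yext in
  let Psi := fun i => psi_ext (yy i) in
  let L := laguerre_cell (truncated_column B P) (cost_ext c yext) yy Psi in
  let T := fun x => \sum_(i < n) \1_(L (lift ord_max i)) x *: y i in
  graph_on B pbar `<=` boundary (L ord_max) /\
  optimal_transport_map (subgraph B pbar) Y c (atomic y m) T /\
  (forall T', optimal_transport_map (subgraph B pbar) Y c (atomic y m) T' ->
     {ae lebesgue_space, forall x, subgraph B pbar x -> T' x = T x}).
Proof.
move=> yy Psi L T; pose sigma z := psi_ext z - psi_ext yext.
pose h := height c y (fun i => sigma (y i)).
have sigma_cont : {within Y, continuous sigma} := extended_price_continuous psi_ext_potential.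
have L_target i : L (lift ord_max i) = target_cell B c y sigma P i.
  exact: (laguerre_target B c yY P psi_ext yextNY i).
have L_dummy : L ord_max = dummy_cell B c y sigma P by
  exact: (laguerre_dummy B c yY P psi_ext yextNY).
have mass k := laguerre_mass B_compact Y_compact c_ge0 c_lipschitz c_increasing
  c_twist yY y_distinct m_sum P_gt0 yextNY nu_extE psi_ext_potential k.
have mass_target i : lebesgue_space (target_cell B c y sigma P i) = (m i)%:E.
  by rewrite -L_target [LHS]mass liftK.
have mass_dummy : lebesgue_space (dummy_cell B c y sigma P) = (P - 1)%:E.
  by rewrite -L_dummy [LHS]mass unlift_none.
have mass_D := extended_mass B_compact Y_compact c_ge0 c_lipschitz yY m_sum
  P_gt0 yextNY nu_extE psi_ext_potential.
have [h_density h_lt] : ac_density B h /\ forall s, B s -> h s < P.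
  apply: (truncated_height_density B_compact Y_nonempty c_ge0 c_lipschitz
    c_increasing yY (ltW P_gt0) P_bound).
  exact: (dummy_cell_mass B_compact c_lipschitz c_increasing yY (ltW P_gt0) mass_D mass_dummy).
have h_pbar s : B s -> h s = pbar s.
  move=> Bs; apply: (pbar_min.2 h); last by rewrite inE.
  exact: (height_continuous_minimiser B_compact Y_compact c_ge0 c_lipschitz
    c_increasing c_twist yY y_distinct m_sum sigma_cont h_density h_lt mass_target).
have subE : subgraph B pbar = subgraph B h.
  by apply/seteqP; split => x [Bx hx]; split => //; move: hx; rewrite h_pbar.
have TE : T = cell_map B c y sigma P.
  by apply/funext => x; rewrite /T /cell_map; apply: eq_bigr => i _; rewrite L_target.
split; [|split].
- (* The points just below the graph are outside the last cell. *)
  move=> _ [s Bs <-]; rewrite -h_pbar// L_dummy.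
  rewrite (dummy_cellE c_lipschitz c_increasing sigma P yY).
  have h0 : 0 <= h s := height_ge0 c_increasing yY _ Bs.
  split.
    apply: subset_closure; split => /=; last exact: lexx.
    by split => //=; rewrite h0/= ltW// h_lt.
  move=> /nbhs_ballP[e /= e0 ball_sub].
  have /ball_sub[_ /=] : ball ((s, h s) : Rspace R d) e (s, h s - e / 2).
    split; first exact: ballxx.
    by rewrite /ball/= opprB addrCA subrr addr0 gtr0_norm ?divr_gt0// ltr_pdivrMr// ltr_pMr// ltr1n.
  by rewrite lerBrDr gerDl leNgt divr_gt0.
- rewrite subE TE.
  exact: (cell_map_optimal B_compact Y_compact c_ge0 c_lipschitz
    c_increasing c_twist yY y_distinct m_sum sigma_cont h_density h_lt mass_target).
- move=> T'; rewrite subE TE.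
  exact: (optimal_map_unique B_compact Y_compact c_ge0 c_lipschitz
    c_increasing c_twist yY y_distinct m_sum sigma_cont h_density h_lt mass_target).
Qed.
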